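(* Let $(P_i, \mathbf{v}_i, e_i)_{i=1}^{\infty}$ be a sequence of tuples where $P_i\subset\mathbb{R}^2$ is a convex polygon, $\mathbf{v}_i$ is a vertex of $P_i$, and $e_i$ is an edge of $P_i$ not incident to $\mathbf{v}_i$. Suppose that: (A1) $\operatorname{diam}(P_i) = 1$ for all $i$; (A2) $e_i$ lies on the $x$-axis for all $i$; (A3) $\mathbf{v}_i$ lies on the positive $y$-axis for all $i$; (A4) for all $i$, $P_i$ lies below a line through $\mathbf{v}_i$ with non-negative slope; (A5) there exists a constant $c_v>0$ (independent of $i$) such that $\operatorname{dist}(\mathbf{o}, \mathbf{v}_e) > c_v$ for each endpoint $\mathbf{v}_e$ of $e_i$ and all $i$, where $\mathbf{o}$ is the origin; (A6) $\operatorname{dist}(\mathbf{v}_i, e_i) \rightarrow 0$ as $i\rightarrow \infty$. Then, for the function $u(x,y) = x^2$, $$\lim_{i\rightarrow \infty} \frac{ |u-I_{P_i} u|_{H^1(P_i)} }{ |u|_{H^2(P_i)} } = \infty,$$ where $I_{P_i}u$ is the harmonic-coordinate interpolant of $u$ on $P_i$.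
   Context: A polygon has a specified list of vertices; interior angles of $180^\circ$ at vertices are allowed, and each segment between consecutive vertices counts as a separate edge. ''Below a line'' is meant non-strictly. Sobolev seminorms: $|w|_{H^m(P)}^2 = \int_P \sum_{|\alpha|=m} |D^\alpha w|^2$. Harmonic interpolant: for $u\in H^2(P)$, let $g_u:\partial P\to\mathbb{R}$ be the function that is linear on each edge of $P$ and equals $u$ at each vertex of $P$. Then $I_P u\in H^1(P)$ is the (unique, weak) solution of $\Delta(I_P u)=0$ in $P$, $I_P u = g_u$ on $\partial P$. *)

(* Defs.v *)
(* The plane is [R * R] with [R : realType].  Its topology
   and differential calculus are those of the library's product normed module
   (whose norm is the max norm), so the Euclidean distance is defined here. *)
From HB Require Import structures.
From mathcomp Require Import all_boot all_order all_algebra.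
From mathcomp Require Import all_classical all_reals all_analysis.

Set Implicit Arguments.
Unset Strict Implicit.
Unset Printing Implicit Defensive.

Import Order.TTheory GRing.Theory Num.Theory numFieldNormedType.Exports.

Local Open Scope classical_set_scope.
Local Open Scope ring_scope.

Section EuclideanPlane.
Variable R : realType.
Implicit Types (p q z : R * R) (A : set (R * R)) (e : (R * R) * (R * R)).

Definition dist p q : R :=
  Num.sqrt ((p.1 - q.1) ^+ 2 + (p.2 - q.2) ^+ 2).

Definition diameter A : R := sup [set dist a.1 a.2 | a in A `*` A].

Definition dist_to_set p A : R := inf [set dist p z | z in A].

Definition boundary A : set (R * R) := closure A `\` A°.

Definition edge_pt e (t : R) : R * R := (1 - t) *: e.1 + t *: e.2.

Definition segment e : set (R * R) := edge_pt e @` `[0, 1].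

End EuclideanPlane.

Section Polygons.
Variable R : realType.
Implicit Types (s : seq (R * R)) (e f : (R * R) * (R * R)).

(* The polygon with vertex list [s]; consecutive vertices, cyclically, span
   its edges. *)
Definition edges s : seq ((R * R) * (R * R)) := zip s (rot 1 s).

Definition polygon_region s : set (R * R) :=
  smallest (@convex_set R (R * R)%type) [set` s].

(* The closed polygonal curve through [s] is simple and is exactly the boundary
   of the convex hull of [s].  Three consecutive vertices may be collinear, and
   both orientations are allowed. *)
Definition convex_polygon s : Prop :=
  [/\ (2 < size s)%N,
      uniq s,
      (polygon_region s)° !=set0,
      boundary (polygon_region s) = \bigcup_(e in [set` edges s]) segment e &
      forall e f, e \in edges s -> f \in edges s -> e != f ->
        segment e `&` segment f `<=`
        [set z | z \in [:: e.1; e.2] /\ z \in [:: f.1; f.2]] ].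

End Polygons.

Section Sobolev.
Variable R : realType.
Implicit Types (Omega K : set (R * R)) (w g phi : R * R -> R).
Implicit Types (al : nat * nat) (z : R * R).

Local Notation leb := (@lebesgue_measure R).
Local Notation leb2 := (leb \x leb)%E.

Definition dx w : R * R -> R := fun z => 'D_((1, 0) : R * R) w z.
Definition dy w : R * R -> R := fun z => 'D_((0, 1) : R * R) w z.

Definition dpartial al w : R * R -> R := iter al.1 dx (iter al.2 dy w).

Fixpoint Ck (k : nat) w : Prop :=
  match k with
  | 0 => continuous w
  | k'.+1 => [/\ forall z, differentiable w z, Ck k' (dx w) & Ck k' (dy w)]
  end.

Definition smooth w : Prop := forall k, Ck k w.

Definition test_function Omega phi : Prop :=
  smooth phi /\
  exists K, [/\ compact K, K `<=` Omega & forall z, ~ K z -> phi z = 0].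

Definition locally_integrable2 Omega w : Prop :=
  forall K, compact K -> K `<=` Omega -> leb2.-integrable K (EFin \o w).

Definition is_weak_partial Omega al w g : Prop :=
  [/\ locally_integrable2 Omega w,
      locally_integrable2 Omega g &
      forall phi, test_function Omega phi ->
        \int[leb2]_(z in Omega) (w z * dpartial al phi z) =
        (-1) ^+ (al.1 + al.2) * \int[leb2]_(z in Omega) (g z * phi z)].

(* A representative of the weak derivative D^al w on Omega (unique up to null
   sets), and 0 if there is none. *)
Definition weak_partial Omega al w : R * R -> R :=
  xget (fun=> 0) [set g | is_weak_partial Omega al w g].

Definition in_sobolev (m : nat) Omega w : Prop :=
  forall al, (al.1 + al.2 <= m)%N ->
  exists2 g, is_weak_partial Omega al w g &
    leb2.-integrable Omega (EFin \o (fun z => g z ^+ 2)).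

Definition sobolev_seminorm (m : nat) Omega w : R :=
  Num.sqrt (\int[leb2]_(z in Omega)
    \sum_(j < m.+1) weak_partial Omega (nat_of_ord j, m - j)%N w z ^+ 2).

Definition sobolev_norm (m : nat) Omega w : R :=
  Num.sqrt (\sum_(k < m.+1) sobolev_seminorm k Omega w ^+ 2).

Definition weakly_harmonic Omega w : Prop :=
  forall phi, test_function Omega phi ->
    \int[leb2]_(z in Omega)
      (weak_partial Omega (1, 0)%N w z * dx phi z +
       weak_partial Omega (0, 1)%N w z * dy phi z) = 0.

End Sobolev.

Section HarmonicInterpolant.
Variable R : realType.
Implicit Types (s : seq (R * R)) (u w g : R * R -> R).

Definition boundary_L2_norm s g : R :=
  Num.sqrt (\sum_(e <- edges s) dist e.1 e.2 *
    \int[@lebesgue_measure R]_(t in `[0, 1]) g (edge_pt e t) ^+ 2).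

(* [g] is the boundary trace of [w]: the trace operator is the continuous
   extension, from H^1 of the polygon to L^2 of its boundary, of the restriction
   of functions smooth up to the boundary. *)
Definition has_trace s w g : Prop :=
  exists phi : nat -> R * R -> R,
    [/\ forall n, smooth (phi n),
        sobolev_norm 1 (polygon_region s)° (phi n \- w) @[n --> \oo] --> 0 &
        boundary_L2_norm s (phi n \- g) @[n --> \oo] --> 0].

(* [g] is constrained only on the boundary of the polygon. *)
Definition piecewise_linear_interpolant s u g : Prop :=
  forall e, e \in edges s -> forall t, t \in `[0, 1] ->
    g (edge_pt e t) = (1 - t) * u e.1 + t * u e.2.

Definition harmonic_interpolant s u w : Prop :=
  [/\ in_sobolev 1 (polygon_region s)° w,
      weakly_harmonic (polygon_region s)° w &
      exists2 g, piecewise_linear_interpolant s u g & has_trace s w g].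

End HarmonicInterpolant.

(* Main.v *)
(* Harmonicity of the interpolant is not needed: its boundary values alone force a
   large gradient.  For large i the origin lies inside e_i, so e_i = [(a, 0), (b, 0)]
   with a, b of opposite signs and |a|, |b| > c.  Write h for the height of v_i.  By
   (A4), P_i is contained in a rectangle of width 2 and height h (1 + 1/c), so
   |u|_{H^2}^2 = 4 |P_i| = O(h).
     Let d = c^2/4 and let D be the part of P_i over -d < x < 0, of area at most d h.
   On the base the interpolant is (a + b) x - a b >= c^2 + x; on the upper boundary over
   D no edge crosses the y-axis, so the chord bound for x^2 gives a value <= -x.  Hence
   the integral of the y-derivative of the interpolant over D is at most -d c^2/2, and
   since u does not depend on y, Cauchy-Schwarz gives
   d c^2/2 <= sqrt (d h) |u - I u|_{H^1}.  The quotient is thus at least a constant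
   times 1/h.
     Traces are defined by approximation, so the inequality is proved for the smooth
   approximants (Fubini and the fundamental theorem of calculus), with errors
   controlled by the L^2 norm on the boundary.  The seminorms are defined from arbitrary
   weak derivatives, which have to be shown unique up to null sets. *)
Require Import Defs.
From HB Require Import structures.
From mathcomp Require Import all_boot all_order all_algebra.
From mathcomp Require Import all_classical all_reals all_analysis.
From mathcomp Require Import ring lra measurable_realfun.

Set Implicit Arguments.
Unset Strict Implicit.
Unset Printing Implicit Defensive.

Import Order.TTheory GRing.Theory Num.Theory numFieldNormedType.Exports.

Local Open Scope classical_set_scope.
Local Open Scope ring_scope.

(** * Borel sets, measure and integrability in the plane *)

Section PlaneMeasure.
Variable R : realType.
Local Notation leb := (@lebesgue_measure R).
Local Notation leb2 := (leb \x leb)%E.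
(* The library measures live on [measurableTypeR R], whose display differs from
   that of the canonical measurable structure of [R]; measurability on the plane
   is therefore always stated on [plane], with the same underlying type. *)
Local Notation plane := (measurableTypeR R * measurableTypeR R)%type.

(** The two boundary bounds differ by at least [c^2 + 2x], which stays above [c^2/2] exactly while
    [x >= -c^2/4]; this is the origin of [d]. The sign in (A4) keeps the part of the polygon left of
    the axis below [v], and makes [v] the highest point over the origin. The slope itself is bounded
    because the supporting line passes above the left end of the base. The obstacle is that the
    interpolant has no usable point values: its derivative is an unspecified representative and its
    boundary values exist only as an L^2 limit. Point values are therefore taken from a smooth
    approximant, and its defect on each edge is carried over to the abscissa. Summing the defects of
    all edges avoids a measurable selection of the edge above a given [x]; the price is a factor
    equal to the number of edges, harmless since the polygon stays fixed while the approximants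
    converge. Uniqueness of weak derivatives is the fundamental lemma of the calculus of variations:
    bumps converging to indicators of rectangles, followed by a Dynkin class argument. *)

Definition obox (c : R * R) (r : R) : set (R * R) :=
  `]c.1 - r, c.1 + r[ `*` `]c.2 - r, c.2 + r[.
Definition cbox (c : R * R) (r : R) : set (R * R) :=
  `[c.1 - r, c.1 + r] `*` `[c.2 - r, c.2 + r].

(** Boxes with rational data are countably many. The closed boxes are kept inside [A] because local
    integrability only speaks about compact subsets. *)
Lemma open_box_cover (A : set (R * R)) : open A ->
  exists s : nat -> (R * R) * R,
    A = \bigcup_n obox (s n).1 (s n).2 /\ forall n, cbox (s n).1 (s n).2 `<=` A.
Proof.
move=> oA.
(* Inadmissible indices get radius [-1], for which both boxes are empty. *)
pose f (i : rat * rat * rat) : (R * R) * R :=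
  if asbool (cbox (ratr i.1.1, ratr i.1.2) (ratr i.2) `<=` A)
  then ((ratr i.1.1, ratr i.1.2), ratr i.2) else ((0, 0), -1).
have fA i : cbox (f i).1 (f i).2 `<=` A.
  rewrite /f; case: asboolP => //= _ z [] /=; rewrite !in_itv/= => /andP[h1 h2].
  by exfalso; lra.
exists (fun n => if unpickle n is Some i then f i else ((0, 0), -1)); split; last first.
  move=> n; case: unpickle => [i|]; first exact: fA.
  move=> z [] /=; rewrite !in_itv/= => /andP[h1 h2] _.
  by exfalso; lra.
apply/seteqP; split => [z Az|z [n _]]; last first.
  case: unpickle => [i|] zb; first apply: (fA i).
    move: zb; rewrite /obox /cbox /= => -[]; rewrite !in_itv/= => /andP[a b] /andP[c d].
    by split; rewrite /= ?in_itv/=; apply/andP; split; lra.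
  by move: zb => [] /=; rewrite !in_itv/= => /andP[h1 h2]; exfalso; lra.
have /nbhs_ballP[e /= e0 be] : nbhs z A by exact: open_nbhs_nbhs.
(* The centre will be within [r] of [z], so the closed box stays within [2 r < e] of [z]. *)
have [r /andP[r0 re]] : exists r, (0 < (ratr r : R)) && ((ratr r : R) < e / 3).
  have [|r] := @rat_in_itvoo R 0 (e / 3); first by lra.
  by rewrite in_itv/= => h; exists r.
have rat_near (x : R) : exists q, `|(ratr q : R) - x| < ratr r.
  have [|q] := @rat_in_itvoo R (x - ratr r) (x + ratr r); first by lra.
  rewrite in_itv/= => /andP[h1 h2]; exists q; rewrite ltr_norml; apply/andP; split; lra.
have [p] := rat_near z.1; have [q] := rat_near z.2.
rewrite !ltr_norml => /andP[q1 q2] /andP[p1 p2].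
exists (pickle (p, q, r)) => //; rewrite pickleK /f; case: asboolP => /=.
  by move=> _; split; rewrite /= ?in_itv/=; apply/andP; split; lra.
case; apply: subset_trans be => -[x y] [] /=; rewrite !in_itv/= => /andP[a b] /andP[c d].
split => /=; rewrite /ball/= ltr_norml; lra.
Qed.

Lemma open_measurable2 (A : set (R * R)) : open A -> measurable (A : set plane).
Proof.
move=> /open_box_cover[s [-> _]]; apply: bigcupT_measurable => n.
by apply: measurableX; exact: measurable_itv.
Qed.

Lemma closed_measurable2 (A : set (R * R)) : closed A -> measurable (A : set plane).
Proof. by move/closed_openC/open_measurable2/measurableC; rewrite setCK. Qed.

Lemma compact_measurable2 (A : set (R * R)) : compact A -> measurable (A : set plane).
Proof.
move/compact_closed => h; apply: closed_measurable2; apply: h.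
exact: norm_hausdorff.
Qed.

Lemma continuous_measurable2 (f : R * R -> R) : continuous f -> measurable_fun (setT : set plane) f.
Proof.
move=> /continuousP cf; apply: (measurability _ (measurable_realfun.RGenOpens.measurableE R)).
move=> _ [_ [a [b ->] <-]]; rewrite setTI; apply: open_measurable2.
exact/cf/interval_open.
Qed.

Lemma rect_measure (a b c d : R) : a <= b -> c <= d ->
  leb2 (`[a, b] `*` `[c, d]) = ((b - a) * (d - c))%:E.
Proof.
move=> ab cd; rewrite product_measure1E//=; try exact: measurable_itv.
by rewrite !lebesgue_measure_itv/= !lte_fin; case: ltrP => h1; case: ltrP => h2;
  rewrite -?EFinD ?mule0 ?mul0e// ; congr EFin; nra.
Qed.

Lemma rect_compact (a b c d : R) : compact (`[a, b] `*` `[c, d] : set (R * R)).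
Proof. by apply: compact_setX; exact: segment_compact. Qed.

Lemma sub_rect_finite (D : set (R * R)) a b c d : measurable (D : set plane) ->
  D `<=` `[a, b] `*` `[c, d] -> (leb2 D < +oo)%E.
Proof.
(* The maxima cover the degenerate case of an empty rectangle, where [rect_measure] does not
   apply. *)
move=> mD DK; apply: (@le_lt_trans _ _ (leb2 (`[a, Num.max a b] `*` `[c, Num.max c d]))).
  apply: le_measure; rewrite ?inE//; first by apply: measurableX; exact: measurable_itv.
  move=> z /DK[] /=; rewrite !in_itv/= => /andP[h1 h2] /andP[h3 h4].
  by split; rewrite /= ?in_itv/= ?h1 ?h3 /= le_max ?h2 ?h4 orbT.
by rewrite rect_measure ?ltry// le_max lexx.
Qed.

Lemma compact_sub_rect (K : set (R * R)) : compact K ->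
  exists2 M : R, 0 < M & K `<=` `]-M, M[ `*` `]-M, M[.
Proof.
move=> /compact_bounded[M [_ Mr]]; exists (`|M| + 2); first by rewrite ltr_wpDl.
move=> z Kz; have M1 : M < `|M| + 1 by have := ler_norm M; lra.
have /= := Mr _ M1 z Kz; rewrite prod_normE /= ge_max => /andP[].
by rewrite !ler_norml => /andP[h1 h2] /andP[h3 h4]; split; rewrite /= ?in_itv/=; apply/andP; split; lra.
Qed.

Lemma compact_finite2 (K : set (R * R)) : compact K -> (leb2 K < +oo)%E.
Proof.
move=> cK; have [M _ KM] := compact_sub_rect cK.
apply: (@sub_rect_finite _ (-M) M (-M) M); first exact: compact_measurable2.
by move=> z /KM[] /=; rewrite !in_itv/= => /andP[h1 h2] /andP[h3 h4]; split;
  rewrite /= ?in_itv/= !ltW.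
Qed.

Lemma continuous_bounded_on (f : R * R -> R) (K : set (R * R)) :
  continuous f -> compact K -> exists M, forall z, K z -> `|f z| <= M.
Proof.
move=> cf cK.
have /compact_bounded[M [_ Mr]] : compact (f @` K).
  by apply: continuous_compact => //; exact: continuous_subspaceT.
exists (`|M| + 1) => z Kz; apply: (Mr (`|M| + 1)); last by exists z.
by rewrite (le_lt_trans (ler_norm M))// ltrDl.
Qed.

Lemma bounded_integrable2 (f : R * R -> R) (D : set (R * R)) M : measurable (D : set plane) ->
  (leb2 D < +oo)%E -> measurable_fun (D : set plane) f -> (forall z, D z -> `|f z| <= M) ->
  leb2.-integrable D (EFin \o f).
Proof.
move=> mD Doo mf fM; apply: measurable_bounded_integrable => //.
exists M; split; first exact: num_real.
by move=> x Mx z Dz; exact: le_trans (fM _ Dz) (ltW Mx).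
Qed.

Lemma continuous_integrable2 (f : R * R -> R) (D K : set (R * R)) :
  continuous f -> measurable (D : set plane) -> compact K -> D `<=` K ->
  leb2.-integrable D (EFin \o f).
Proof.
move=> cf mD cK DK; have [M fM] := continuous_bounded_on cf cK.
apply: (@bounded_integrable2 _ _ M) => //.
- apply: le_lt_trans (compact_finite2 cK); apply: le_measure; rewrite ?inE//.
  exact: compact_measurable2.
- by apply: measurable_funS (continuous_measurable2 cf).
- by move=> z /DK; exact: fM.
Qed.

End PlaneMeasure.

(** * Flat functions built from [exp (-1/t)] *)

Section SmoothCutoff.
Variable R : realType.
Implicit Types (p : {poly R}) (t : R).

(* [poly_exp_inv 1] is the classical function [exp (-1/t)] extended by [0]; the
   polynomial factor makes the family stable under differentiation. *)
Definition poly_exp_inv p t : R :=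
  if 0 < t then p.[t^-1] * expR (- t^-1) else 0.

Lemma expr_expRN_bounded n : exists C, forall s : R, 0 <= s -> s ^+ n * expR (- s) <= C.
Proof.
case: n => [|n].
  by exists 1 => s s0; rewrite expr0 mul1r -expR0 ler_expR; lra.
exists (n.+1`!%:R) => s s0; rewrite expRN ler_pdivrMr ?expR_gt0//.
rewrite mulrC -ler_pdivrMr ?ltr0n ?fact_gt0//.
by apply: le_trans (expR_ge1Dxn n s0); rewrite lerDr.
Qed.

(** With [s = 1/t], each monomial of [p] is controlled by [exp s >= s^n / n!]. *)
Lemma poly_exp_inv_bounded p : exists2 C, 0 <= C & forall t, `|poly_exp_inv p t| <= C.
Proof.
have [C hC] : exists C, forall s : R, 0 <= s -> `|p.[s]| * expR (- s) <= C.
  pose F n := projT1 (cid (expr_expRN_bounded n)).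
  have hF n s : 0 <= s -> s ^+ n * expR (- s) <= F n.
    by move=> s0; exact: (projT2 (cid (expr_expRN_bounded n))).
  exists (\sum_(i < size p) `|p`_i| * F i) => s s0.
  rewrite horner_coef (le_trans (ler_wpM2r (expR_ge0 _) (ler_norm_sum _ _ _)))//.
  rewrite mulr_suml; apply: ler_sum => i _.
  rewrite normrM -mulrA ler_wpM2l// ger0_norm ?exprn_ge0//; exact: hF.
have C0 : 0 <= C by apply: le_trans (hC 0 (lexx _)); rewrite mulr_ge0 ?expR_ge0.
exists C => // t; rewrite /poly_exp_inv; case: ifPn => t0; last by rewrite normr0.
by rewrite normrM [X in _ * X]ger0_norm ?expR_ge0// hC// invr_ge0 ltW.
Qed.

(** Boundedness for ['X^2 * p] is this very estimate, since ['X^2] evaluates to [t^-2]. It makes the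
    derivative at [0] vanish. *)
Lemma poly_exp_inv_quad p : exists2 C, 0 <= C &
  forall t, `|poly_exp_inv p t| <= C * t ^+ 2.
Proof.
have [C C0 hC] := poly_exp_inv_bounded ('X ^+ 2 * p).
exists C => // t; have := hC t; rewrite /poly_exp_inv; case: ifPn => t0.
  rewrite hornerM hornerXn => h.
  have tn : t != 0 by rewrite gt_eqF.
  have -> : p.[t^-1] * expR (- t^-1) = (t^-1 ^+ 2 * p.[t^-1] * expR (- t^-1)) * t ^+ 2.
    by field.
  by rewrite normrM [X in _ * X]ger0_norm ?sqr_ge0// ler_wpM2r ?sqr_ge0.
by rewrite normr0 => _; rewrite mulr_ge0 ?sqr_ge0.
Qed.

(** For [t > 0] the chain rule turns [p] into ['X^2 * (p - p')]. One formula valid at every [t],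
    including [0], yields derivatives of all orders. *)
Lemma is_derive_poly_exp_inv p t :
  is_derive t 1 (poly_exp_inv p) (poly_exp_inv ('X ^+ 2 * (p - p^`())) t).
Proof.
have [t0|t0|->] := ltgtP t 0.
- rewrite [X in is_derive _ _ _ X](_ : _ = 0 :> R); last by rewrite /poly_exp_inv ltNge (ltW t0).
  have d0 : is_derive t (1 : R) (cst (0 : R)) 0 by exact: is_derive_cst.
  apply: near_eq_is_derive d0.
  near=> x; rewrite /poly_exp_inv /= ifF//.
  apply/negbTE; rewrite -leNgt; apply/ltW; near: x.
  exact: lt_nbhsl.
- pose q (s : R) := p.[s] * expR (- s).
  apply: (@near_eq_is_derive _ _ _ (q \o (fun x => x^-1))).
    near=> x; rewrite /poly_exp_inv /= ifT//; near: x; exact: lt_nbhsr.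
  have dq (s : R) : is_derive s (1 : R) q ((p^`() - p).[s] * expR (- s)).
    have h : is_derive s (1 : R) (horner p * (expR \o -%R))
        (p.[s] *: (expR (- s) * (- 1)) + expR (- s) *: p^`().[s]).
      apply: is_deriveM.
    by apply: is_derive_eq; rewrite hornerD hornerN /GRing.scale/=; ring.
  have dinv : is_derive t (1 : R) (fun x : R => x^-1) (- t ^- 2).
    have tn : t != 0 by rewrite gt_eqF.
    by have := @is_deriveV R id t 1 1 tn (is_derive_id _ _); rewrite /GRing.scale/= mulr1.
  apply: is_derive_eq; rewrite /poly_exp_inv t0 /GRing.scale/= hornerM hornerXn !hornerD !hornerN.
  by rewrite exprVn; ring.
- rewrite [X in is_derive _ _ _ X](_ : _ = 0 :> R); last by rewrite /poly_exp_inv ltxx.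
  have [C C0 hC] := poly_exp_inv_quad p.
  have lim0 : (fun h => h^-1 *: ((poly_exp_inv p \o shift 0) (h *: 1) - poly_exp_inv p 0))
      @ (0 : R)^' --> (0 : R).
    apply/cvgrPdist_le => e e0; near=> h.
    rewrite sub0r normrN /= addr0 /GRing.scale/= mulr1 {2}/poly_exp_inv ltxx subr0.
    rewrite normrM normfV ler_pdivrMl; last first.
      by rewrite normr_gt0; near: h; exact: nbhs_dnbhs_neq.
    apply: (le_trans (hC h)); rewrite -[h ^+ 2]real_normK ?num_real// expr2 mulrCA ler_wpM2l//.
    (* The [+ 1] avoids dividing by zero when [C = 0]. *)
    have : `|h| <= e / (C + 1).
      near: h; apply: nbhs_dnbhs; apply/nbhs_normP; exists (e / (C + 1)).
        by rewrite /= divr_gt0// ltr_wpDl.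
      by move=> x /=; rewrite sub0r normrN => /ltW.
    rewrite ler_pdivlMr ?ltr_wpDl// => h1; apply: le_trans h1.
    by rewrite mulrC ler_wpM2l// lerDl.
  by apply: DeriveDef; [apply/cvg_ex; exists 0|exact: cvg_lim].
Unshelve. all: by end_near. Qed.

End SmoothCutoff.

(** * Partial derivatives, smooth functions and bumps in the plane *)

Section PlaneCalculus.
Variable R : realType.
Implicit Types (w f g : R * R -> R) (z : R * R).

Lemma dxE w x y : dx w (x, y) = (fun t => w (t, y))^`()%classic x.
Proof.
rewrite /dx /derive1 /derive; set d := (fun _ : R => _); set d' := (fun _ : R => _).
suff -> : d = d' by [].
apply/funext => h; rewrite /d /d' /=.
suff -> : h *: ((1, 0) : R * R) + (x, y) = (h + x, y) by [].
by transitivity (h * 1 + x, h * 0 + y); [reflexivity|rewrite mulr1 mulr0 add0r].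
Qed.

Lemma dyE w x y : dy w (x, y) = (fun t => w (x, t))^`()%classic y.
Proof.
rewrite /dy /derive1 /derive; set d := (fun _ : R => _); set d' := (fun _ : R => _).
suff -> : d = d' by [].
apply/funext => h; rewrite /d /d' /=.
suff -> : h *: ((0, 1) : R * R) + (x, y) = (x, h + y) by [].
by transitivity (h * 0 + x, h * 1 + y); [reflexivity|rewrite mulr1 mulr0 add0r].
Qed.

Lemma derivable_sectionx w x y : differentiable w (x, y) ->
  derivable (fun t => w (t, y)) x 1.
Proof.
move=> dw; apply/derivable1_diffP; apply: (@differentiable_comp _ _ _ _ (fun t => (t, y)) w) => //.
Qed.

Lemma derivable_sectiony w x y : differentiable w (x, y) ->
  derivable (fun t => w (x, t)) y 1.
Proof.
move=> dw; apply/derivable1_diffP; apply: (@differentiable_comp _ _ _ _ (fun t => (x, t)) w) => //.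
Qed.

Lemma deriveM_plane (v z : R * R) f g : differentiable f z -> differentiable g z ->
  'D_v (f \* g) z = 'D_v f z * g z + f z * 'D_v g z.
Proof.
move=> df dg; rewrite deriveM; [|exact: diff_derivable..].
by rewrite addrC /GRing.scale/= mulrC.
Qed.

Lemma Ck_continuous k w : Ck k w -> continuous w.
Proof.
by case: k => [//|k] /= [dw _ _] z; exact: differentiable_continuous.
Qed.

Lemma CkW k w : Ck k.+1 w -> Ck k w.
Proof.
elim: k w => [|k IH] w; first exact: Ck_continuous.
move=> [dw cx cy]; split; [exact: dw|exact: IH cx|exact: IH cy].
Qed.

Lemma CkD k f g : Ck k f -> Ck k g -> Ck k (f \+ g).
Proof.
elim: k f g => [|k IH] f g /=; first by move=> cf cg z; exact: cvgD (cf z) (cg z).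
move=> [df fx fy] [dg gx gy]; split.
- by move=> z; exact: differentiableD.
- rewrite (_ : dx (f \+ g) = dx f \+ dx g); first exact: IH.
  by apply/funext => z; rewrite /dx/= deriveD//; exact: diff_derivable.
- rewrite (_ : dy (f \+ g) = dy f \+ dy g); first exact: IH.
  by apply/funext => z; rewrite /dy/= deriveD//; exact: diff_derivable.
Qed.

Lemma CkM k f g : Ck k f -> Ck k g -> Ck k (f \* g).
Proof.
elim: k f g => [|k IH] f g; first by move=> cf cg z; exact: cvgM (cf z) (cg z).
move=> cf cg; have [df fx fy] := cf; have [dg gx gy] := cg.
have cf' := CkW cf; have cg' := CkW cg.
split.
- by move=> z; exact: differentiableM.
- rewrite (_ : dx (f \* g) = (dx f \* g) \+ (f \* dx g)); first by apply: CkD; exact: IH.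
  by apply/funext => z; rewrite /dx/= deriveM_plane.
- rewrite (_ : dy (f \* g) = (dy f \* g) \+ (f \* dy g)); first by apply: CkD; exact: IH.
  by apply/funext => z; rewrite /dy/= deriveM_plane.
Qed.

Lemma smoothM f g : smooth f -> smooth g -> smooth (f \* g).
Proof. by move=> sf sg k; exact: CkM. Qed.

Lemma smooth_dx f : smooth f -> smooth (dx f).
Proof. by move=> sf k; have [] := sf k.+1. Qed.

Lemma smooth_dy f : smooth f -> smooth (dy f).
Proof. by move=> sf k; have [] := sf k.+1. Qed.

Lemma smooth_continuous f : smooth f -> continuous f.
Proof. by move=> sf; exact: (Ck_continuous (sf 0)). Qed.

Lemma smooth_differentiable f z : smooth f -> differentiable f z.
Proof. by move=> sf; have [] := sf 1. Qed.

Lemma dx_cst c : dx (fun=> c : R) = fun=> 0 :> R.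
Proof. by apply/funext => z; exact: derive_cst. Qed.

Lemma dy_cst c : dy (fun=> c : R) = fun=> 0 :> R.
Proof. by apply/funext => z; exact: derive_cst. Qed.

Lemma smooth_cst c : smooth (fun=> c : R).
Proof.
move=> k; elim: k c => [|k IH] c /=; first by move=> z; exact: cvg_cst.
split; [by move=> z; exact: differentiable_cst|by rewrite dx_cst|by rewrite dy_cst].
Qed.

Lemma dx_fst (a : R -> R) : dx (fun z => a z.1) = fun z => a^`()%classic z.1.
Proof. by apply/funext => -[x y]; rewrite dxE. Qed.

Lemma dy_fst (a : R -> R) : dy (fun z => a z.1) = fun=> 0.
Proof. by apply/funext => -[x y]; rewrite dyE (_ : (fun t => _) = cst (a x)) ?derive1_cst. Qed.

Lemma dx_snd (a : R -> R) : dx (fun z => a z.2) = fun=> 0.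
Proof. by apply/funext => -[x y]; rewrite dxE (_ : (fun t => _) = cst (a y)) ?derive1_cst. Qed.

Lemma dy_snd (a : R -> R) : dy (fun z => a z.2) = fun z => a^`()%classic z.2.
Proof. by apply/funext => -[x y]; rewrite dyE. Qed.

Lemma differentiable_fst_comp (a : R -> R) z : derivable a z.1 1 ->
  differentiable (fun z => a z.1) z.
Proof.
move=> /derivable1_diffP da.
by apply: (@differentiable_comp _ _ _ _ fst a) => //;
  apply: (@linear_differentiable _ _ _ (@fst R R)) => x; exact: cvg_fst.
Qed.

Lemma differentiable_snd_comp (a : R -> R) z : derivable a z.2 1 ->
  differentiable (fun z => a z.2) z.
Proof.
move=> /derivable1_diffP da.
by apply: (@differentiable_comp _ _ _ _ snd a) => //;
  apply: (@linear_differentiable _ _ _ (@snd R R)) => x; exact: cvg_snd.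
Qed.

(** Induction on the order of differentiation replaces [a] by its derivative, so it has to run over
    a whole class stable under derivation. *)
Lemma smooth_fst_family (F : set (R -> R)) :
  (forall a, F a -> (forall t, derivable a t (1 : R)) /\ F (a^`()%classic)) ->
  forall a, F a -> smooth (fun z => a z.1).
Proof.
move=> hF a Fa k; elim: k a Fa => [|k IH] a Fa; have [da Fa'] := hF a Fa.
  by move=> z; apply: differentiable_continuous; exact: differentiable_fst_comp.
split; first by move=> z; exact: differentiable_fst_comp.
- by rewrite dx_fst; exact: IH.
- by rewrite dy_fst; exact: smooth_cst.
Qed.

Lemma smooth_snd_family (F : set (R -> R)) :
  (forall a, F a -> (forall t, derivable a t (1 : R)) /\ F (a^`()%classic)) ->
  forall a, F a -> smooth (fun z => a z.2).
Proof.
move=> hF a Fa k; elim: k a Fa => [|k IH] a Fa; have [da Fa'] := hF a Fa.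
  by move=> z; apply: differentiable_continuous; exact: differentiable_snd_comp.
split; first by move=> z; exact: differentiable_snd_comp.
- by rewrite dx_snd; exact: smooth_cst.
- by rewrite dy_snd; exact: IH.
Qed.

Lemma smooth_fst : smooth (@fst R R).
Proof.
suff h : forall a : R -> R, [set a | a = id \/ exists c, a = cst c] a ->
    (forall t, derivable a t (1 : R)) /\ [set a | a = id \/ exists c, a = cst c] (a^`()%classic).
  by apply: (@smooth_fst_family _ h id); left.
move=> a [->|[c ->]]; split => [t|].
- exact: derivable_id.
- by right; exists 1; apply/funext => t; rewrite derive1_id.
- exact: derivable_cst.
- by right; exists 0; apply/funext => t; rewrite derive1_cst.
Qed.

(** The class fed to [smooth_fst_family] and [smooth_snd_family]: the factor [al] produced by the
    chain rule is absorbed by the polynomial. *)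
Definition affine_poly_exp_inv (al be : R) (a : R -> R) : Prop :=
  exists p, a = fun t => poly_exp_inv p (al * t + be).

Lemma affine_poly_exp_inv_derive al be a : affine_poly_exp_inv al be a ->
  (forall t, derivable a t (1 : R)) /\ affine_poly_exp_inv al be (a^`()%classic).
Proof.
move=> [p ->].
have h (t : R) : is_derive t 1 (fun t => poly_exp_inv p (al * t + be))
    (poly_exp_inv (al *: ('X ^+ 2 * (p - p^`()))) (al * t + be)).
  have hl : is_derive t 1 (fun t => al * t + be) al.
    by apply: is_derive_eq; rewrite /GRing.scale/=; ring.
  have hp := is_derive_poly_exp_inv p (al * t + be).
  have hc := @is_derive1_comp R (poly_exp_inv p) (fun t => al * t + be) t _ _ hp hl.
  apply: (is_derive_eq hc).
  by rewrite /poly_exp_inv; case: ifP => _; rewrite ?hornerZ /GRing.scale/=; ring.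
split=> [t|]; first by have [] := h t.
by eexists; apply/funext => t; rewrite derive1E; have [_ ->] := h t.
Qed.

(* Replacing [exp (-1/t)] by its (n+1)-th root [exp (-1/((n+1) t))] makes the bumps
   converge to the indicator function of the interval. *)
Definition bump1 (n : nat) (a b t : R) : R :=
  poly_exp_inv 1 (n.+1%:R * t + - (n.+1%:R * a)) *
  poly_exp_inv 1 (- n.+1%:R * t + n.+1%:R * b).

Lemma bump1_out n a b t : ~~ (t \in `]a, b[) -> bump1 n a b t = 0.
Proof.
rewrite in_itv/= negb_and -!leNgt /bump1 /poly_exp_inv => /orP[h|h].
  rewrite ifF ?mul0r//; apply/negbTE; rewrite -leNgt -mulrBr.
  by rewrite mulr_ge0_le0// subr_le0.
rewrite [X in _ * X]ifF ?mulr0//; apply/negbTE; rewrite -leNgt addrC mulNr -mulrBr.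
by rewrite mulr_ge0_le0// subr_le0.
Qed.

Lemma bump1_bound n a b t : `|bump1 n a b t| <= 1.
Proof.
have h s : `|poly_exp_inv (1 : {poly R}) s| <= 1.
  rewrite /poly_exp_inv; case: ifPn => s0; last by rewrite normr0.
  by rewrite hornerC mul1r ger0_norm ?expR_ge0// expR_le1 oppr_le0 invr_ge0 ltW.
by rewrite /bump1 normrM -[leRHS]mulr1 ler_pM.
Qed.

Lemma bump1_cvg a b t : t \in `]a, b[ -> bump1 n a b t @[n --> \oo] --> (1 : R).
Proof.
rewrite in_itv/= => /andP[ta tb].
have h (s : R) : 0 < s -> poly_exp_inv 1 (n.+1%:R * s) @[n --> \oo] --> (1 : R).
  move=> s0; rewrite (_ : (fun n => _) = fun n => expR (- (s^-1 * harmonic n))); last first.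
    apply/funext => n; rewrite /poly_exp_inv mulr_gt0// hornerC mul1r invfM; congr (expR (- _)).
    by rewrite mulrC.
  rewrite -expR0; apply: continuous_cvg; first exact: continuous_expR.
  rewrite -[X in _ --> X]oppr0; apply: cvgN; rewrite -[X in _ --> X](mulr0 s^-1).
  by apply: cvgM; [exact: cvg_cst|exact: cvg_harmonic].
rewrite -[X in _ --> X]mulr1; apply: cvgM.
  by under eq_cvg do rewrite -mulrBr; apply: h; rewrite subr_gt0.
by under eq_cvg do rewrite addrC mulNr -mulrBr; apply: h; rewrite subr_gt0.
Qed.

Definition bump (n : nat) (a b c d : R) (z : R * R) : R :=
  bump1 n a b z.1 * bump1 n c d z.2.

Lemma smooth_bump n a b c d : smooth (bump n a b c d).
Proof.
have sx al be : smooth (fun z : R * R => poly_exp_inv 1 (al * z.1 + be)).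
  apply: (@smooth_fst_family _ (@affine_poly_exp_inv_derive al be)
    (fun t => poly_exp_inv 1 (al * t + be))).
  by exists 1.
have sy al be : smooth (fun z : R * R => poly_exp_inv 1 (al * z.2 + be)).
  apply: (@smooth_snd_family _ (@affine_poly_exp_inv_derive al be)
    (fun t => poly_exp_inv 1 (al * t + be))).
  by exists 1.
apply: (@smoothM (fun z => bump1 n a b z.1) (fun z => bump1 n c d z.2)).
- exact: smoothM (sx _ _) (sx _ _).
- exact: smoothM (sy _ _) (sy _ _).
Qed.

End PlaneCalculus.

(** * Open rectangles as a pi-system generating the Borel sets *)

Section BoxGenerators.
Variable R : realType.

Definition open_rects : set (set (R * R)) :=
  [set A | exists a b c d : R, A = `]a, b[ `*` `]c, d[].

Lemma itvoo_setI (a b a' b' : R) :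
  (`]a, b[ `&` `]a', b'[)%classic = `]Num.max a a', Num.min b b'[%classic.
Proof.
apply/seteqP; split => t /=; rewrite !in_itv/=.
  by move=> [/andP[h1 h2] /andP[h3 h4]]; rewrite gt_max lt_min h1 h2 h3 h4.
by rewrite gt_max lt_min => /andP[/andP[-> ->] /andP[-> ->]].
Qed.

Lemma open_rects_setI : setI_closed open_rects.
Proof.
move=> _ _ [a [b [c [d ->]]]] [a' [b' [c' [d' ->]]]].
by do 4 eexists; rewrite -setXI !itvoo_setI; reflexivity.
Qed.

(** A measurable rectangle is the intersection of a vertical and a horizontal cylinder, and the
    cylinders reduce to the generation of one-dimensional Borel sets by open intervals. *)
Lemma measurable_open_rects (A : set (R * R)) :
  measurable (A : set (measurableTypeR R * measurableTypeR R)%type) -> <<s open_rects >> A.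
Proof.
(* Exhausts the unbounded side of a cylinder by bounded rectangles. *)
have bigcup_itv : \bigcup_n `](- n%:R), n%:R[%classic = [set: R].
  apply/seteqP; split => // t _; exists (Num.truncn `|t|).+1 => //=.
  by rewrite in_itv/= -ltr_norml truncnS_gt.
have mX (B : set R) : measurable B -> <<s open_rects >> (B `*` [set: R]).
  move=> mB; have {mB} : (@ocitv R).-sigma.-measurable B by exact: mB.
  rewrite measurable_realfun.RGenOpens.measurableE; move: B.
  pose S := [set B | <<s open_rects >> (B `*` [set: R])].
  apply: (@smallest_sub _ _ _ S); first split.
  - by rewrite /S/= set0X; exact: (@measurable0 _ (g_sigma_algebraType open_rects)).
  - move=> B; rewrite /S/= setTD => mB.
    have -> : ~` B `*` [set: R] = ~` (B `*` [set: R]).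
      by apply/seteqP; split => -[x y] /=; tauto.
    exact: (@measurableC _ (g_sigma_algebraType open_rects)).
  - move=> F mF; rewrite /S/= setX_bigcupl.
    exact: (@bigcupT_measurable _ (g_sigma_algebraType open_rects)).
  - move=> _ [a [b ->]]; rewrite /S/= -bigcup_itv setX_bigcupr.
    apply: (@bigcupT_measurable _ (g_sigma_algebraType open_rects)) => n.
    by apply: sub_sigma_algebra; do 4 eexists.
have mY (B : set R) : measurable B -> <<s open_rects >> ([set: R] `*` B).
  move=> mB; have {mB} : (@ocitv R).-sigma.-measurable B by exact: mB.
  rewrite measurable_realfun.RGenOpens.measurableE; move: B.
  pose S := [set B | <<s open_rects >> ([set: R] `*` B)].
  apply: (@smallest_sub _ _ _ S); first split.
  - by rewrite /S/= setX0; exact: (@measurable0 _ (g_sigma_algebraType open_rects)).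
  - move=> B; rewrite /S/= setTD => mB.
    have -> : [set: R] `*` ~` B = ~` ([set: R] `*` B).
      by apply/seteqP; split => -[x y] /=; tauto.
    exact: (@measurableC _ (g_sigma_algebraType open_rects)).
  - move=> F mF; rewrite /S/= setX_bigcupr.
    exact: (@bigcupT_measurable _ (g_sigma_algebraType open_rects)).
  - move=> _ [a [b ->]]; rewrite /S/= -bigcup_itv setX_bigcupl.
    apply: (@bigcupT_measurable _ (g_sigma_algebraType open_rects)) => n.
    by apply: sub_sigma_algebra; do 4 eexists.
rewrite measurable_prod_measurableType; apply: smallest_sub.
  exact: smallest_sigma_algebra.
move=> _ [B mB [C mC <-]].
rewrite (_ : B `*` C = (B `*` setT) `&` (setT `*` C)); last first.
  by rewrite -setXI setIT setTI.
by apply: (@measurableI _ (g_sigma_algebraType open_rects)); [exact: mX|exact: mY].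
Qed.

End BoxGenerators.

(** * Integration by parts; classical derivatives are weak derivatives *)

Section WeakDerivatives.
Variable R : realType.
Local Notation leb := (@lebesgue_measure R).
Local Notation leb2 := (leb \x leb)%E.
Local Notation plane := (measurableTypeR R * measurableTypeR R)%type.
Implicit Types (Omega K : set (R * R)) (w g phi : R * R -> R).

Lemma derive_off_support (v : R * R) K phi : closed K ->
  (forall z, ~ K z -> phi z = 0) -> forall z, ~ K z -> 'D_v phi z = 0.
Proof.
move=> cK phi0 z nKz; rewrite (@near_eq_derive _ _ _ _ (cst 0)) ?derive_cst//.
have : nbhs z (~` K) by apply: open_nbhs_nbhs; split => //; exact: closed_openC.
by apply: filterS => y /phi0.
Qed.

Lemma compact_closed2 K : compact K -> closed K.
Proof. by move=> cK; apply: compact_closed => //; exact: norm_hausdorff. Qed.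

Lemma test_function_dx Omega phi : test_function Omega phi -> test_function Omega (dx phi).
Proof.
move=> [sphi [K [cK KO phi0]]]; split; first exact: smooth_dx.
by exists K; split => //; apply: derive_off_support => //; exact: compact_closed2.
Qed.

Lemma test_function_dy Omega phi : test_function Omega phi -> test_function Omega (dy phi).
Proof.
move=> [sphi [K [cK KO phi0]]]; split; first exact: smooth_dy.
by exists K; split => //; apply: derive_off_support => //; exact: compact_closed2.
Qed.

Lemma test_function_dpartial Omega al phi :
  test_function Omega phi -> test_function Omega (dpartial al phi).
Proof.
move=> tphi; rewrite /dpartial; elim: al.1 => [|m IH] /=; last exact: test_function_dx.
by elim: al.2 => [//|n IH] /=; exact: test_function_dy.
Qed.

Lemma restrict_support Omega K (f : R * R -> R) : K `<=` Omega ->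
  (forall z, ~ K z -> f z = 0) -> f \_ Omega = f \_ K.
Proof.
move=> KO f0; apply/funext => z; rewrite !patchE.
case: (asboolP (K z)) => Kz; first by rewrite !mem_set//; exact: KO.
by rewrite f0// !if_same.
Qed.

(** The product vanishes off the compact support of [phi], on which [w] is integrable and [phi]
    bounded. *)
Lemma locally_integrable_mul Omega w phi : measurable (Omega : set plane) ->
  locally_integrable2 Omega w -> test_function Omega phi ->
  leb2.-integrable Omega (EFin \o (w \* phi)).
Proof.
move=> mO lw [sphi [K [cK KO phi0]]]; have mK := compact_measurable2 cK.
apply: (iffRL (integrable_mkcond _ mO)).
rewrite restrict_EFin (@restrict_support _ K) => // [|z /phi0 e]; last by rewrite /= e mulr0.
rewrite -restrict_EFin; apply: (iffLR (integrable_mkcond _ mK)).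
have cphi := smooth_continuous sphi.
have [M hM] := continuous_bounded_on cphi cK.
have mphi : measurable_fun (K : set plane) phi by apply: measurable_funS (continuous_measurable2 cphi).
have bphi : [bounded phi x | x in K].
  exists M; split; first exact: num_real.
  by move=> x Mx z Kz; exact: le_trans (hM _ Kz) (ltW Mx).
exact: (integrableMl mK (lw K cK KO) mphi bphi).
Qed.

Lemma continuous_locally_integrable Omega w : continuous w -> locally_integrable2 Omega w.
Proof.
by move=> cw K cK _; apply: (@continuous_integrable2 _ _ _ K) => //; exact: compact_measurable2.
Qed.

Lemma locally_integrableB Omega w g : locally_integrable2 Omega w ->
  locally_integrable2 Omega g -> locally_integrable2 Omega (w \- g).
Proof.
move=> lw lg K cK KO; have mK := compact_measurable2 cK.
exact: (@integrableB _ _ _ leb2 K mK (EFin \o w) (EFin \o g) (lw _ cK KO) (lg _ cK KO)).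
Qed.

Lemma is_weak_partialB Omega al w1 w2 g1 g2 : measurable (Omega : set plane) ->
  is_weak_partial Omega al w1 g1 -> is_weak_partial Omega al w2 g2 ->
  is_weak_partial Omega al (w1 \- w2) (g1 \- g2).
Proof.
move=> mO [lw1 lg1 h1] [lw2 lg2 h2]; split; try exact: locally_integrableB.
move=> phi tphi; have tD := test_function_dpartial al tphi.
under eq_Rintegral do rewrite mulrBl.
under [in RHS]eq_Rintegral do rewrite mulrBl.
rewrite !RintegralB//; try exact: locally_integrable_mul.
by rewrite h1// h2// mulrBr.
Qed.

Lemma compact_support_integrable phi K : continuous phi -> compact K ->
  (forall z, ~ K z -> phi z = 0) -> leb2.-integrable setT (EFin \o phi).
Proof.
move=> cphi cK phi0; rewrite (_ : phi = phi \_ K); last by rewrite -(@restrict_support setT) ?patch_setT.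
rewrite -restrict_EFin; have mK := compact_measurable2 cK.
apply: (iffLR (integrable_mkcond _ mK)); exact: (@continuous_integrable2 _ _ _ K).
Qed.

Lemma integral_derive1 (F : R -> R) a b : a < b -> (forall t, derivable F t (1 : R)) ->
  continuous (F^`()%classic : R -> R) ->
  (\int[leb]_(t in `[a, b]) (F^`()%classic t)%:E = (F b - F a)%:E)%E.
Proof.
move=> ab dF cF; have contF t : {for t, continuous F}.
  by apply: differentiable_continuous; exact/derivable1_diffP.
have cw : {within `[a, b], continuous (F^`()%classic : R -> R)} by exact: continuous_subspaceT.
have dF' : derivable_oo_LRcontinuous F a b.
  split; [by move=> t _; exact: dF|by apply: cvg_at_right_filter; exact: contF|].
  by apply: cvg_at_left_filter; exact: contF.
by rewrite (continuous_FTC2 ab cw dF' (fun _ _ => erefl)).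
Qed.

Lemma integral_compact_support1 (F : R -> R) (M : R) : 0 < M ->
  (forall t, derivable F t (1 : R)) -> continuous (F^`()%classic : R -> R) ->
  (forall t, ~ (t \in `]-M, M[) -> F t = 0) ->
  (forall t, ~ (t \in `]-M, M[) -> F^`()%classic t = 0) ->
  (\int[leb]_t (F^`()%classic t)%:E = 0)%E.
Proof.
move=> M0 dF cF F0 F'0.
pose D : set R := `[-M, M]%classic.
transitivity (\int[leb]_(t in D) (F^`()%classic t)%:E)%E.
  rewrite [RHS]integral_mkcond; apply: eq_integral => t _; rewrite patchE.
  case: ifPn => //; rewrite notin_setE => /= ht; rewrite F'0//.
  by move=> h; apply: ht; exact: subset_itv_oo_cc.
by rewrite /D integral_derive1// ?F0 ?subrr// ?in_itv/= ?ltxx ?andbF//; lra.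
Qed.

Lemma continuous_pairl (y : R) : continuous (fun t : R => (t, y)).
Proof. by move=> t; apply: differentiable_continuous. Qed.

Lemma continuous_pairr (x : R) : continuous (fun t : R => (x, t)).
Proof. by move=> t; apply: differentiable_continuous. Qed.

(** By Fubini it is enough to integrate along horizontal lines, where the fundamental theorem of
    calculus gives a difference of two zero values. *)
Lemma integral_dx_compact_support F K : (forall z, differentiable F z) ->
  continuous (dx F) -> compact K -> (forall z, ~ K z -> F z = 0) ->
  (\int[leb2]_z (dx F z)%:E = 0)%E.
Proof.
move=> dF cF cK F0; have cK' := compact_closed2 cK.
have F'0 : forall z, ~ K z -> dx F z = 0 by exact: derive_off_support.
have [M M0 KM] := compact_sub_rect cK.
rewrite -integral21_prod_meas1; last exact: compact_support_integrable cK F'0.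
rewrite integral0_eq// => y _; rewrite /fubini_G.
have nK x : ~ (x \in `]-M, M[) -> ~ K (x, y) by move=> h /KM [/= ].
under eq_integral do rewrite dxE.
apply: (@integral_compact_support1 _ M) => //.
- by move=> t; exact: derivable_sectionx.
- rewrite (_ : _^`()%classic = dx F \o (fun t => (t, y))); last first.
    by apply/funext => t; rewrite /= dxE.
  move=> t; apply: continuous_comp; last exact: cF.
  exact: continuous_pairl.
- by move=> t /nK /F0.
- by move=> t /nK /F'0; rewrite dxE.
Qed.

Lemma integral_dy_compact_support F K : (forall z, differentiable F z) ->
  continuous (dy F) -> compact K -> (forall z, ~ K z -> F z = 0) ->
  (\int[leb2]_z (dy F z)%:E = 0)%E.
Proof.
move=> dF cF cK F0; have cK' := compact_closed2 cK.
have F'0 : forall z, ~ K z -> dy F z = 0 by exact: derive_off_support.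
have [M M0 KM] := compact_sub_rect cK.
rewrite -integral12_prod_meas1; last exact: compact_support_integrable cK F'0.
rewrite integral0_eq// => x _; rewrite /fubini_F.
have nK y : ~ (y \in `]-M, M[) -> ~ K (x, y) by move=> h /KM [/= ].
under eq_integral do rewrite dyE.
apply: (@integral_compact_support1 _ M) => //.
- by move=> t; exact: derivable_sectiony.
- rewrite (_ : _^`()%classic = dy F \o (fun t => (x, t))); last first.
    by apply/funext => t; rewrite /= dyE.
  move=> t; apply: continuous_comp; last exact: cF.
  exact: continuous_pairr.
- by move=> t /nK /F0.
- by move=> t /nK /F'0; rewrite dyE.
Qed.

(** The two integrands add up to the derivative of [w * phi], which has compact support. The second
    hypothesis states that such derivatives integrate to zero, so both coordinate directions share
    the argument. *)
Lemma by_parts_direction (v : R * R) Omega w phi : measurable (Omega : set plane) ->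
  (forall F K, (forall z, differentiable F z) -> continuous (fun z => 'D_v F z) ->
    compact K -> (forall z, ~ K z -> F z = 0) ->
    (\int[leb2]_z ('D_v F z)%:E = 0)%E) ->
  smooth w -> continuous (fun z => 'D_v w z) ->
  test_function Omega phi -> test_function Omega (fun z => 'D_v phi z) ->
  \int[leb2]_(z in Omega) (w z * 'D_v phi z) =
  - \int[leb2]_(z in Omega) ('D_v w z * phi z).
Proof.
move=> mO H sw cw tphi tdphi.
have i1 : leb2.-integrable Omega (EFin \o (w \* (fun z => 'D_v phi z))).
  apply: locally_integrable_mul => //; apply: continuous_locally_integrable.
  exact: smooth_continuous.
have i2 : leb2.-integrable Omega (EFin \o ((fun z => 'D_v w z) \* phi)).
  by apply: locally_integrable_mul => //; exact: continuous_locally_integrable.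
apply/eqP; rewrite -addr_eq0 -RintegralD//.
have [sphi [K [cK KO phi0]]] := tphi; have [sdphi _] := tdphi.
have dw z : differentiable w z by exact: smooth_differentiable.
have dphi z : differentiable phi z by exact: smooth_differentiable.
have dF z : differentiable (w \* phi) z by exact: differentiableM.
have DE z : 'D_v (w \* phi) z = w z * 'D_v phi z + 'D_v w z * phi z.
  by rewrite deriveM_plane// addrC.
under eq_Rintegral do rewrite -DE.
have F0 z : ~ K z -> (w \* phi) z = 0 by move=> /phi0 /= ->; rewrite mulr0.
have F'0 : forall z, ~ K z -> 'D_v (w \* phi) z = 0.
  by apply: derive_off_support => //; exact: compact_closed2.
(* Off [K] the integrand is zero, so [Omega] may be exchanged for the whole plane. *)
rewrite Rintegral_mkcond (@restrict_support _ K)// -(@restrict_support setT K)//.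
rewrite patch_setT /Rintegral (H _ K)//.
rewrite (_ : (fun z => _) = (w \* (fun z => 'D_v phi z)) \+ ((fun z => 'D_v w z) \* phi)).
  have cw0 := smooth_continuous sw; have cphi := smooth_continuous sphi.
  have cdphi := smooth_continuous sdphi.
  by move=> z; exact: (cvgD (cvgM (cw0 z) (cdphi z)) (cvgM (cw z) (cphi z))).
by apply/funext => z; exact: DE.
Qed.

Lemma by_parts_dx Omega w phi : measurable (Omega : set plane) -> smooth w -> test_function Omega phi ->
  \int[leb2]_(z in Omega) (w z * dx phi z) = - \int[leb2]_(z in Omega) (dx w z * phi z).
Proof.
move=> mO sw tphi; apply: by_parts_direction => //; first exact: integral_dx_compact_support.
  by apply: smooth_continuous; exact: smooth_dx.
exact: test_function_dx.
Qed.

Lemma by_parts_dy Omega w phi : measurable (Omega : set plane) -> smooth w -> test_function Omega phi ->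
  \int[leb2]_(z in Omega) (w z * dy phi z) = - \int[leb2]_(z in Omega) (dy w z * phi z).
Proof.
move=> mO sw tphi; apply: by_parts_direction => //; first exact: integral_dy_compact_support.
  by apply: smooth_continuous; exact: smooth_dy.
exact: test_function_dy.
Qed.

(** [dpartial] applies [dx] outermost to [phi], so integration by parts moves the [dx] onto [w]
    before the [dy]. Stating the result in this reversed order avoids the symmetry of mixed
    derivatives. *)
Lemma smooth_weak_partial Omega al w : measurable (Omega : set plane) -> smooth w ->
  is_weak_partial Omega al w (iter al.2 (@dy R) (iter al.1 (@dx R) w)).
Proof.
move=> mO sw; have sit k l : smooth (iter l (@dy R) (iter k (@dx R) w)).
  elim: l => [|l IH] /=; last exact: smooth_dy.
  by elim: k => [//|k IH] /=; exact: smooth_dx.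
split; try by apply: continuous_locally_integrable; exact: smooth_continuous.
move=> phi tphi; rewrite /dpartial.
have tx k l : test_function Omega (iter k (@dx R) (iter l (@dy R) phi)).
  exact: (test_function_dpartial (k, l)).
transitivity ((-1) ^+ al.1 *
    \int[leb2]_(z in Omega) (iter al.1 (@dx R) w z * iter al.2 (@dy R) phi z)).
  have := sit ^~ 0%N; move: al.1 => k {}sit; elim: k w sw sit => [|k IH] w0 sw0 sit.
    by rewrite expr0 mul1r.
  rewrite [iter k.+1 _ (iter _ _ _)]iterS (by_parts_dx mO sw0 (tx _ _)).
  rewrite IH; last 2 first.
  - exact: smooth_dx.
  - by move=> j; have := sit j.+1; rewrite /= -iterSr.
  by rewrite exprS mulN1r mulNr -iterSr.
rewrite exprD -mulrA; congr (_ * _).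
have sv : smooth (iter al.1 (@dx R) w) by exact: (sit _ 0%N).
move: (iter al.1 _ _) sv => v; elim: al.2 v => [|l IH] v0 sv.
  by rewrite expr0 mul1r.
rewrite [iter l.+1 _ phi]iterS (by_parts_dy mO sv (tx 0%N _)).
rewrite IH; last exact: smooth_dy.
by rewrite exprS mulN1r mulNr -iterSr.
Qed.

End WeakDerivatives.

(** * Uniqueness of weak derivatives up to null sets *)

Section Uniqueness.
Variable R : realType.
Local Notation leb := (@lebesgue_measure R).
Local Notation leb2 := (leb \x leb)%E.
Local Notation plane := (measurableTypeR R * measurableTypeR R)%type.
Implicit Types (Omega K : set (R * R)) (w g h phi : R * R -> R).

Lemma measurable_orect (a b c d : R) : measurable (`]a, b[ `*` `]c, d[ : set plane).
Proof. by apply: measurableX; exact: measurable_itv. Qed.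

Lemma test_bump Omega n a b c d : `[a, b] `*` `[c, d] `<=` Omega ->
  test_function Omega (@bump R n a b c d).
Proof.
move=> KO; split; first exact: smooth_bump.
exists (`[a, b] `*` `[c, d]); split => //; first exact: rect_compact.
move=> -[x y] /= nK; rewrite /bump /=.
case: (boolP (x \in `]a, b[)) => hx; last by rewrite bump1_out ?mul0r.
case: (boolP (y \in `]c, d[)) => hy; last by rewrite [X in _ * X]bump1_out ?mulr0.
by exfalso; apply: nK; split => /=; exact: subset_itv_oo_cc.
Qed.

Lemma bump_cvg a b c d z :
  @bump R n a b c d z @[n --> \oo] --> (\1_(`]a, b[ `*` `]c, d[) z : R).
Proof.
rewrite indicE; case: (boolP (z \in _)) => [|]; rewrite ?inE ?notin_setE.
  by move=> [zx zy]; rewrite -[X in _ --> X]mulr1; apply: cvgM; exact: bump1_cvg.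
move=> nz; apply: cvg_near_cst; apply: nearW => n; rewrite /bump.
case: (boolP (z.1 \in `]a, b[)) => hx; last by rewrite bump1_out ?mul0r.
case: (boolP (z.2 \in `]c, d[)) => hy; last by rewrite [X in _ * X]bump1_out ?mulr0.
by exfalso; apply: nz.
Qed.

Lemma bump_bound n a b c d z : `|@bump R n a b c d z| <= 1.
Proof. by rewrite /bump normrM -[leRHS]mulr1 ler_pM// bump1_bound. Qed.

(** The bumps are test functions tending pointwise to the indicator of the open rectangle. Dominated
    convergence applies with [|h|], integrable on the closed rectangle. *)
Lemma integral_orect_eq0 Omega h (a b c d : R) : measurable (Omega : set plane) ->
  locally_integrable2 Omega h ->
  (forall phi, test_function Omega phi -> \int[leb2]_(z in Omega) (h z * phi z) = 0) ->
  `[a, b] `*` `[c, d] `<=` Omega ->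
  (\int[leb2]_(z in `]a, b[ `*` `]c, d[) (h z)%:E = 0)%E.
Proof.
move=> mO lh h0 KO; set K : set plane := `[a, b] `*` `[c, d]; set B : set plane := `]a, b[ `*` `]c, d[.
have cK : compact (K : set (R * R)) by exact: rect_compact.
have mK : measurable K by exact: compact_measurable2.
have mB : measurable B by exact: measurable_orect.
have BK : B `<=` K by move=> z [z1 z2]; split; exact: subset_itv_oo_cc.
have ih : leb2.-integrable K (EFin \o h) by exact: lh.
have mh : measurable_fun K h by apply/measurable_EFinP; exact: measurable_int ih.
pose f_ n : plane -> \bar R := EFin \o (h \* bump n a b c d).
pose f : plane -> \bar R := EFin \o (h \* \1_B).
have mf_ n : measurable_fun K (f_ n).
  apply/measurable_EFinP; apply: measurable_funM => //.
  apply: measurable_funS (continuous_measurable2 _) => //.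
  by apply: smooth_continuous; exact: smooth_bump.
have mf : measurable_fun K f.
  have mB1 : measurable_fun K (\1_B : plane -> R) by exact: measurable_indic.
  by apply/measurable_EFinP; exact: measurable_funM mh mB1.
have f_f : {ae leb2, forall z, K z -> f_ ^~ z @ \oo --> f z}.
  apply: aeW => z _; apply: cvg_EFin; first exact: nearW.
  by apply: cvgM; [exact: cvg_cst|exact: bump_cvg].
have f_g : {ae leb2, forall z n, K z -> (`|f_ n z| <= (abse \o (EFin \o h)) z)%E}.
  apply: aeW => z n _; rewrite /f_ /= lee_fin normrM -[leRHS]mulr1.
  by rewrite ler_wpM2l// bump_bound.
have [_ _] := dominated_convergence mK mf_ mf f_f (integrable_abse ih) f_g.
have -> : [sequence (\int[leb2]_(z in K) f_ n z)%E]_n = cst 0%E.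
  apply/funext => n /=; have tb := test_bump n KO.
  have i1 := locally_integrable_mul mO lh tb.
  have b0 z : ~ K z -> (h \* bump n a b c d) z = 0.
    move=> nK; rewrite /= /bump.
    case: (boolP (z.1 \in `]a, b[)) => hx; last by rewrite bump1_out ?mul0r ?mulr0.
    case: (boolP (z.2 \in `]c, d[)) => hy; last by rewrite [X in _ * (_ * X)]bump1_out ?mulr0.
    by exfalso; apply: nK; apply: BK.
  transitivity (\int[leb2]_(z in Omega) (h z * bump n a b c d z)%:E)%E.
    rewrite integral_mkcond [RHS]integral_mkcond; apply: eq_integral => z _.
    rewrite !patchE /f_ /=; case: (asboolP (K z)) => Kz; first by rewrite !mem_set//; exact: KO.
    by have /= -> := b0 z Kz; rewrite !if_same.
  rewrite -[LHS]fineK; last exact: (integrable_fin_num mO i1).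
  by have := h0 _ tb; rewrite /Rintegral => ->.
move=> /(cvg_lim (@ereal_hausdorff R)); rewrite lim_cst; last exact: ereal_hausdorff.
move=> f0; rewrite [RHS]f0.
rewrite -[X in integral _ X _ = _](setIidr BK) integral_mkcondr.
apply: eq_integral => z _; rewrite /f patchE /= indicE.
by case: ifP => _; rewrite ?mulr1 ?mulr0.
Qed.

(** The fundamental lemma of the calculus of variations. A countable cover reduces it to one
    rectangle, where vanishing integrals over all measurable parts force [h = 0] almost
    everywhere. *)
Lemma integral_ae0 Omega h : open Omega -> locally_integrable2 Omega h ->
  (forall phi, test_function Omega phi -> \int[leb2]_(z in Omega) (h z * phi z) = 0) ->
  {ae leb2, forall z, Omega z -> h z = 0}.
Proof.
move=> oO lh h0; have mO := open_measurable2 oO.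
have [s [Os sO]] := open_box_cover oO.
suff Hn n : {ae leb2, forall z, obox (s n).1 (s n).2 z -> h z = 0}.
  have : leb2.-negligible (\bigcup_n ~` [set z | obox (s n).1 (s n).2 z -> h z = 0]).
    by apply: negligible_bigcup => n; exact: Hn.
  apply: negligibleS => z /= /not_implyP[]; rewrite {1}Os => -[n _ zn] hz.
  by exists n => //= /(_ zn).
suff H (a b c d : R) : `[a, b] `*` `[c, d] `<=` Omega ->
    {ae leb2, forall z, (`]a, b[ `*` `]c, d[) z -> h z = 0} by apply: H; exact: sO.
move=> KO; set Q : set plane := `]a, b[ `*` `]c, d[.
have mQ : measurable Q by exact: measurable_orect.
have QK : Q `<=` `[a, b] `*` `[c, d] by move=> z [z1 z2]; split; exact: subset_itv_oo_cc.
have cK : compact (`[a, b] `*` `[c, d] : set (R * R)) by exact: rect_compact.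
have iQ : leb2.-integrable Q (EFin \o h).
  by apply: integrableS (lh _ cK KO) => //; exact: compact_measurable2.
suff HQ E : measurable (E : set plane) -> (\int[leb2]_(z in E `&` Q) (h z)%:E = 0)%E.
  have : ae_eq leb2 Q (EFin \o h) (cst 0%E).
    apply: integral_ae_eq => // E EQ mE.
    by rewrite [RHS]integral0 -(setIidl EQ); exact: HQ.
  by apply: filterS => z /= hz /hz [].
(* [S] is a Dynkin class containing the open rectangles, which are stable under intersection; hence
   it contains every Borel set. *)
pose S := [set E : set plane | measurable E /\ (\int[leb2]_(z in E `&` Q) (h z)%:E = 0)%E].
move=> mE; suff [] : S E by [].
move: mE => /measurable_open_rects; rewrite -(setI_closed_g_dynkin_g_sigma_algebra (@open_rects_setI R)).
apply: (@smallest_sub _ _ _ S) => {E}; first split.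
- split; first exact: measurableT.
  by rewrite setTI; exact: (integral_orect_eq0 mO).
- move=> E [mE E0]; split; first exact: measurableC.
  have : (\int[leb2]_(z in (E `&` Q) `|` (~` E `&` Q)) (h z)%:E = 0)%E.
    by rewrite -setIUl setUCr setTI; exact: (integral_orect_eq0 mO).
  rewrite integral_setU//; last 4 first.
  + exact: measurableI.
  + by apply: measurableI => //; exact: measurableC.
  + rewrite -setIUl setUCr setTI; exact: measurable_int iQ.
  + by apply/disj_setPS => z [[Ez _] [nEz _]].
  by rewrite E0 add0e.
- move=> F tF SF; split; first by apply: bigcupT_measurable => k; have [] := SF k.
  rewrite setI_bigcupl integral_bigcup.
  + by apply: eseries0 => k _ _; have [] := SF k.
  + by apply: trivIset_setIr.
  + by move=> k; apply: measurableI => //; have [] := SF k.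
  + rewrite -setI_bigcupl; apply: integrableS iQ => //.
    apply: measurableI => //; apply: bigcupT_measurable => k; by have [] := SF k.
- move=> _ [a' [b' [c' [d' ->]]]]; split; first exact: measurable_orect.
  rewrite -setXI !itvoo_setI; apply: (integral_orect_eq0 mO) => //.
  apply: subset_trans KO => z [] /=; rewrite !in_itv/=.
  rewrite !ge_max !le_min => /andP[/andP[_ h1] /andP[_ h2]] /andP[/andP[_ h3] /andP[_ h4]].
  by split; rewrite /= ?in_itv/= ?h1 ?h2 ?h3 ?h4.
Qed.

Lemma weak_partial_unique Omega al w g1 g2 : open Omega ->
  is_weak_partial Omega al w g1 -> is_weak_partial Omega al w g2 ->
  {ae leb2, forall z, Omega z -> g1 z = g2 z}.
Proof.
move=> oO [lw lg1 h1] [_ lg2 h2]; have mO := open_measurable2 oO.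
have : {ae leb2, forall z, Omega z -> (g1 \- g2) z = 0}.
  apply: integral_ae0 => //; first exact: locally_integrableB.
  move=> phi tphi; under eq_Rintegral do rewrite mulrBl.
  rewrite RintegralB//; try exact: locally_integrable_mul.
  apply/eqP; rewrite subr_eq0; apply/eqP.
  have := h1 _ tphi; rewrite h2// => /esym; apply: mulfI.
  by rewrite expf_neq0// oppr_eq0 oner_eq0.
apply: negligibleS => z /=; apply: contra_not => hz Oz.
by apply/eqP; rewrite -subr_eq0; apply/eqP; exact: hz.
Qed.

End Uniqueness.

(** * Square-integrable functions on sets of finite measure *)

Section CauchySchwarz.
Context d (T : measurableType d) (R : realType) (mu : {measure set T -> \bar R}).

Lemma ae_impl (P Q : T -> Prop) : (forall z, P z -> Q z) ->
  {ae mu, forall z, P z} -> {ae mu, forall z, Q z}.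
Proof. exact: filterS. Qed.

Lemma ae_and (P Q : T -> Prop) : {ae mu, forall z, P z} -> {ae mu, forall z, Q z} ->
  {ae mu, forall z, P z /\ Q z}.
Proof. exact: filterI. Qed.

Lemma integrable_cst_finite (D : set T) (c : R) : measurable D ->
  (mu D < +oo)%E -> mu.-integrable D (EFin \o cst c).
Proof.
move=> mD Doo; apply: measurable_bounded_integrable => //.
by exists `|c|; split; [exact: num_real|move=> x cx z _; exact: ltW].
Qed.

(** From [|x| <= 1 + x^2], the constant [1] being integrable. *)
Lemma sqr_integrable_integrable (D : set T) (f : T -> R) : measurable D ->
  (mu D < +oo)%E -> measurable_fun D f ->
  mu.-integrable D (EFin \o (fun z => f z ^+ 2)) -> mu.-integrable D (EFin \o f).
Proof.
move=> mD Doo mf if2.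
have i1 : mu.-integrable D (EFin \o cst 1) by exact: integrable_cst_finite.
have := integrableD mD i1 if2; apply: le_integrable => //.
  exact/measurable_EFinP.
move=> z _; rewrite /= lee_fin; set x := f z.
rewrite [leRHS]ger0_norm; last by rewrite addr_ge0// sqr_ge0.
by rewrite ler_norml; apply/andP; split; nra.
Qed.

(** The integral of [(t - f)^2] is a quadratic polynomial in [t] that is never negative. *)
Lemma cauchy_schwarz_finite (D : set T) (f : T -> R) : measurable D ->
  (mu D < +oo)%E -> measurable_fun D f ->
  mu.-integrable D (EFin \o (fun z => f z ^+ 2)) ->
  (\int[mu]_(z in D) f z) ^+ 2 <= fine (mu D) * \int[mu]_(z in D) f z ^+ 2.
Proof.
move=> mD Doo mf if2; have if1 := sqr_integrable_integrable mD Doo mf if2.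
set m := fine _; set F := Rintegral _ _ _; set S := Rintegral _ _ _.
have m0 : 0 <= m by rewrite fine_ge0.
have H (t : R) : 0 <= t ^+ 2 * m - 2 * t * F + S.
  have i1 : mu.-integrable D (EFin \o cst (t ^+ 2)) by exact: integrable_cst_finite.
  have i2 : mu.-integrable D (EFin \o (fun z => 2 * t * f z)).
    by have := integrableZl mD (2 * t) if1; apply: eq_integrable.
  have -> : t ^+ 2 * m - 2 * t * F + S = \int[mu]_(z in D) (t - f z) ^+ 2.
    rewrite /m /F /S -Rintegral_cst// -RintegralZl// -RintegralB// -RintegralD//; last first.
      exact: (integrableB mD i1 i2).
    by apply: eq_Rintegral => z _; rewrite /=; ring.
  by apply: Rintegral_ge0 => z _; rewrite sqr_ge0.
have [m1|m1] := ltP 0 m.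
  (* [F / m] minimises the quadratic. *)
  have := H (F / m); rewrite -(ler_pM2l m1) mulr0.
  have -> : m * ((F / m) ^+ 2 * m - 2 * (F / m) * F + S) = m * S - F ^+ 2.
    by field; rewrite gt_eqF.
  by rewrite subr_ge0.
have m2 : m = 0 by lra.
have [->|F0] := eqVneq F 0; first by rewrite expr0n/= m2 mul0r.
(* When [m = 0] the polynomial is affine with slope [- 2 F]; this [t] would give it the value
   [-1]. *)
have := H ((S + 1) / (2 * F)); rewrite m2 mulr0 sub0r.
have -> : - (2 * ((S + 1) / (2 * F)) * F) + S = -1 by field.
by rewrite lerNr oppr0 ler10.
Qed.

Lemma ae_eq_integrable (D : set T) (f g : T -> R) : measurable D ->
  measurable_fun D g -> {ae mu, forall z, D z -> f z = g z} ->
  mu.-integrable D (EFin \o f) -> mu.-integrable D (EFin \o g).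
Proof.
move=> mD mg fg if1; apply/integrableP; split; first exact/measurable_EFinP.
have [mf foo] := integrableP _ _ _ if1; apply: le_lt_trans foo.
rewrite (@ae_eq_integral _ _ _ mu D (abse \o (EFin \o f)) (abse \o (EFin \o g)))//.
- by do 2 apply: measurableT_comp => //.
- by apply: measurableT_comp.
- by apply: filterS fg => z h Dz /=; rewrite h.
Qed.

Lemma ae_eq_Rintegral (D : set T) (f g : T -> R) : measurable D ->
  measurable_fun D f -> measurable_fun D g -> {ae mu, forall z, D z -> f z = g z} ->
  \int[mu]_(z in D) f z = \int[mu]_(z in D) g z.
Proof.
move=> mD mf mg fg; rewrite /Rintegral (@ae_eq_integral _ _ _ mu D (EFin \o g) (EFin \o f))//.
- exact/measurable_EFinP.
- exact/measurable_EFinP.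
- by apply: filterS fg => z h Dz /=; rewrite h.
Qed.

Lemma subset_Rintegral (A B : set T) (f : T -> R) : measurable A -> measurable B ->
  A `<=` B -> (forall z, 0 <= f z) -> mu.-integrable B (EFin \o f) ->
  \int[mu]_(z in A) f z <= \int[mu]_(z in B) f z.
Proof.
move=> mA mB AB f0 iB; have iA := integrableS mB mA AB iB.
apply: fine_le; [exact: integrable_fin_num|exact: integrable_fin_num|].
apply: ge0_subset_integral => //; first exact: measurable_int iB.
by move=> z _; rewrite lee_fin.
Qed.

Lemma sqr_integrableB (D : set T) (f g : T -> R) : measurable D ->
  measurable_fun D f -> measurable_fun D g ->
  mu.-integrable D (EFin \o (fun z => f z ^+ 2)) ->
  mu.-integrable D (EFin \o (fun z => g z ^+ 2)) ->
  mu.-integrable D (EFin \o (fun z => (f z - g z) ^+ 2)).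
Proof.
move=> mD mf mg if2 ig2.
have := integrableZl mD 2 (integrableD mD if2 ig2).
apply: le_integrable => //.
  by apply/measurable_EFinP; apply: measurable_funX; exact: measurable_funB.
move=> z _; rewrite /= lee_fin.
rewrite ger0_norm ?sqr_ge0// ger0_norm; last by rewrite mulr_ge0// addr_ge0// sqr_ge0.
rewrite -subr_ge0; have -> : 2 * (f z ^+ 2 + g z ^+ 2) - (f z - g z) ^+ 2 = (f z + g z) ^+ 2 by ring.
exact: sqr_ge0.
Qed.

End CauchySchwarz.

(** * Sobolev seminorms through arbitrary representatives *)

Section Seminorms.
Variable R : realType.
Local Notation leb := (@lebesgue_measure R).
Local Notation leb2 := (leb \x leb)%E.
Local Notation plane := (measurableTypeR R * measurableTypeR R)%type.
Implicit Types (Omega K : set (R * R)) (w g h phi p q : R * R -> R).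

(** Measurability is known on compact subsets only; a countable cover by boxes glues it together. *)
Lemma locally_integrable_measurable Omega g : open Omega ->
  locally_integrable2 Omega g -> measurable_fun (Omega : set plane) g.
Proof.
move=> oO lg; have [s [Os sO]] := open_box_cover oO.
rewrite Os; apply/measurable_fun_bigcup => n.
  by apply: measurableX; exact: measurable_itv.
have cK : compact (cbox (s n).1 (s n).2) by exact: rect_compact.
have /measurable_int/measurable_EFinP := lg _ cK (sO n).
apply: measurable_funS; first exact: compact_measurable2.
by move=> z [z1 z2]; split; exact: subset_itv_oo_cc.
Qed.

Lemma weak_partialP Omega al w g : is_weak_partial Omega al w g ->
  is_weak_partial Omega al w (weak_partial Omega al w).
Proof. by move=> h; rewrite /weak_partial; case: xgetP => [x -> //|/(_ g)]. Qed.

Lemma smooth_sqr_integrable Omega K p : open Omega -> compact K -> Omega `<=` K ->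
  continuous p -> leb2.-integrable Omega (EFin \o (fun z => p z ^+ 2)).
Proof.
move=> oO cK OK cp; apply: (@continuous_integrable2 _ _ _ K) => //.
  by move=> z; rewrite (_ : (fun z => _) = p \* p)//; exact: cvgM (cp z) (cp z).
exact: open_measurable2.
Qed.

Lemma sobolev_seminorm1E Omega w : sobolev_seminorm 1 Omega w =
  Num.sqrt (\int[leb2]_(z in Omega) (weak_partial Omega (0, 1)%N w z ^+ 2 +
                                     weak_partial Omega (1, 0)%N w z ^+ 2)).
Proof.
have E (F : nat * nat -> R) :
    \sum_(j < 2) F (nat_of_ord j, 1 - j)%N = F (0, 1)%N + F (1, 0)%N.
  by rewrite !big_ord_recl big_ord0 addr0.
rewrite /sobolev_seminorm; congr (Num.sqrt (Rintegral _ _ _)); apply/funext => z.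
exact: (E (fun al => weak_partial Omega al w z ^+ 2)).
Qed.

Lemma sobolev_seminorm2E Omega w : sobolev_seminorm 2 Omega w =
  Num.sqrt (\int[leb2]_(z in Omega) (weak_partial Omega (0, 2)%N w z ^+ 2 +
    (weak_partial Omega (1, 1)%N w z ^+ 2 + weak_partial Omega (2, 0)%N w z ^+ 2))).
Proof.
have E (F : nat * nat -> R) :
    \sum_(j < 3) F (nat_of_ord j, 2 - j)%N = F (0, 2)%N + (F (1, 1)%N + F (2, 0)%N).
  by rewrite !big_ord_recl big_ord0 addr0.
rewrite /sobolev_seminorm; congr (Num.sqrt (Rintegral _ _ _)); apply/funext => z.
exact: (E (fun al => weak_partial Omega al w z ^+ 2)).
Qed.

Section SmoothMinusSobolev.
Variables (Omega K : set (R * R)) (w : R * R -> R).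
Hypotheses (oO : open Omega) (cK : compact K) (OK : Omega `<=` K).

Lemma domain_finite : (leb2 Omega < +oo)%E.
Proof.
apply: le_lt_trans (compact_finite2 cK); apply: le_measure; rewrite ?inE//.
  exact: open_measurable2.
exact: compact_measurable2.
Qed.

(** The derivative hidden in the seminorm is an arbitrary choice [G]; uniqueness identifies it with
    the explicit difference, whose square integrability it inherits. At order one the reversed order
    in [smooth_weak_partial] makes no difference. *)
Lemma weak_partial_smoothB al p g : smooth p -> (al = (1, 0) \/ al = (0, 1))%N ->
  is_weak_partial Omega al w g ->
  leb2.-integrable Omega (EFin \o (fun z => g z ^+ 2)) ->
  let G := weak_partial Omega al (p \- w) in
  [/\ {ae leb2, forall z, Omega z -> dpartial al p z - g z = G z},
      measurable_fun (Omega : set plane) G &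
      leb2.-integrable Omega (EFin \o (fun z => G z ^+ 2))].
Proof.
move=> sp hal wg ig G; have mO := open_measurable2 oO.
have wp : is_weak_partial Omega al p (dpartial al p).
  by case: hal => ->; exact: (smooth_weak_partial _ mO sp).
have wB := is_weak_partialB mO wp wg.
have wG := weak_partialP wB.
have ae : {ae leb2, forall z, Omega z -> dpartial al p z - g z = G z}.
  exact: weak_partial_unique oO wB wG.
have mG : measurable_fun (Omega : set plane) G.
  by apply: locally_integrable_measurable => //; case: wG.
have mg : measurable_fun (Omega : set plane) g.
  by apply: locally_integrable_measurable => //; case: wg.
have cd : continuous (dpartial al p).
  by case: hal => ->; apply: smooth_continuous; [exact: smooth_dx|exact: smooth_dy].
split => //.
apply: (@ae_eq_integrable _ _ _ leb2 Omega (fun z => (dpartial al p z - g z) ^+ 2)) => //.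
- by apply: measurable_funX.
- by apply: ae_impl ae => z hz Oz; rewrite hz.
apply: sqr_integrableB => //.
- exact: measurable_funS (continuous_measurable2 cd).
- exact: (smooth_sqr_integrable oO cK OK cd).
Qed.

(** Cauchy-Schwarz on [D]; the right-hand side then grows by enlarging [D] to [Omega] and by adding
    the squared [x]-derivative. *)
Lemma integral_dy_le_seminorm p gx g (D : set plane) : smooth p ->
  is_weak_partial Omega (1, 0)%N w gx ->
  leb2.-integrable Omega (EFin \o (fun z => gx z ^+ 2)) ->
  is_weak_partial Omega (0, 1)%N w g ->
  leb2.-integrable Omega (EFin \o (fun z => g z ^+ 2)) ->
  measurable D -> D `<=` Omega ->
  `|\int[leb2]_(z in D) (dy p z - g z)| <=
    Num.sqrt (fine (leb2 D)) * sobolev_seminorm 1 Omega (p \- w).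
Proof.
move=> sp wgx igx wg ig mD DO; have mO : measurable (Omega : set plane) := open_measurable2 oO.
have [_ mX iX] := weak_partial_smoothB sp (or_introl erefl) wgx igx.
have [aeG mG iG] := weak_partial_smoothB sp (or_intror erefl) wg ig.
set G := weak_partial Omega (0, 1)%N (p \- w) in aeG mG iG *.
set X := weak_partial Omega (1, 0)%N (p \- w) in mX iX *.
have mg : measurable_fun (Omega : set plane) g.
  by apply: locally_integrable_measurable => //; case: wg.
have cd : continuous (dy p) by apply: smooth_continuous; exact: smooth_dy.
have Doo : (leb2 D < +oo)%E.
  by apply: le_lt_trans domain_finite; apply: le_measure; rewrite ?inE.
have mGD : measurable_fun D G by exact: measurable_funS mG.
have -> : \int[leb2]_(z in D) (dy p z - g z) = \int[leb2]_(z in D) G z.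
  apply: ae_eq_Rintegral => //.
    apply: measurable_funB; last exact: measurable_funS mg.
    exact: measurable_funS (continuous_measurable2 cd).
  by apply: ae_impl aeG => z hz Dz; rewrite -hz//; exact: DO.
have iGD : leb2.-integrable D (EFin \o (fun z => G z ^+ 2)) by exact: integrableS iG.
have cs := cauchy_schwarz_finite mD Doo mGD iGD.
rewrite sobolev_seminorm1E -sqrtr_sqr -sqrtrM ?fine_ge0// ler_wsqrtr//.
apply: (le_trans cs); rewrite ler_wpM2l ?fine_ge0//.
have sD : \int[leb2]_(z in D) G z ^+ 2 <= \int[leb2]_(z in Omega) G z ^+ 2.
  by apply: (subset_Rintegral mD mO DO _ iG) => z; exact: sqr_ge0.
apply: (le_trans sD).
apply: (le_Rintegral mO iG (integrableD mO iG iX)) => z _.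
by rewrite lerDl sqr_ge0.
Qed.

End SmoothMinusSobolev.

(** A weak [y]-derivative of [w] is inserted between the two. It will be applied to an approximant
    [p] of [w] and to [q = u], whose [y]-derivative is zero. *)
Lemma sobolev_seminorm_triangle Omega K w p q (D : set plane) : open Omega ->
  compact K -> Omega `<=` K -> in_sobolev 1 Omega w -> smooth p -> smooth q ->
  measurable D -> D `<=` Omega ->
  `|\int[leb2]_(z in D) (dy p z - dy q z)| <= Num.sqrt (fine (leb2 D)) *
    (sobolev_seminorm 1 Omega (p \- w) + sobolev_seminorm 1 Omega (q \- w)).
Proof.
move=> oO cK OK sw sp sq mD DO.
have [gx wx ix] := sw (1, 0)%N isT; have [g wg ig] := sw (0, 1)%N isT.
have mO : measurable (Omega : set plane) := open_measurable2 oO.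
have hp := integral_dy_le_seminorm oO cK OK sp wx ix wg ig mD DO.
have hq := integral_dy_le_seminorm oO cK OK sq wx ix wg ig mD DO.
have Ooo := domain_finite oO cK OK.
have Doo : (leb2 D < +oo)%E.
  by apply: le_lt_trans Ooo; apply: le_measure; rewrite ?inE.
have mg : measurable_fun (Omega : set plane) g.
  by apply: locally_integrable_measurable => //; case: wg.
have igD : leb2.-integrable D (EFin \o g).
  apply: sqr_integrable_integrable => //; first exact: measurable_funS mg.
  exact: integrableS ig.
have idy r : smooth r -> leb2.-integrable D (EFin \o dy r).
  move=> sr; apply: (@continuous_integrable2 _ _ _ K) => //.
    by apply: smooth_continuous; exact: smooth_dy.
  exact: subset_trans DO OK.
have ip := idy _ sp; have iq := idy _ sq.
have -> : \int[leb2]_(z in D) (dy p z - dy q z) =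
    \int[leb2]_(z in D) (dy p z - g z) - \int[leb2]_(z in D) (dy q z - g z).
  rewrite (RintegralB mD ip iq) (RintegralB mD ip igD) (RintegralB mD iq igD).
  by rewrite opprB addrA subrK.
by apply: (le_trans (ler_normB _ _)); rewrite mulrDr; exact: lerD hp hq.
Qed.

Lemma dx_sqr_fst : dx (fun z : R * R => z.1 ^+ 2) = fun z => z.1 + z.1.
Proof.
rewrite (dx_fst (fun t => t ^+ 2)); apply/funext => z.
by rewrite exp_derive1 expr1 scaler_nat mulr2n.
Qed.

Lemma smooth_sqr_fst : smooth (fun z : R * R => z.1 ^+ 2).
Proof. by rewrite (_ : (fun _ => _) = fst \* fst)//; exact: smoothM (@smooth_fst R) (@smooth_fst R). Qed.

Lemma sobolev_seminorm2_sqr_fst Omega : open Omega ->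
  sobolev_seminorm 2 Omega (fun z : R * R => z.1 ^+ 2) =
  Num.sqrt (4 * fine (leb2 Omega)).
Proof.
move=> oO; have mO : measurable (Omega : set plane) := open_measurable2 oO.
set u := fun z : R * R => z.1 ^+ 2.
have rep al c : iter al.2 (@dy R) (iter al.1 (@dx R) u) = cst c ->
    measurable_fun (Omega : set plane) (weak_partial Omega al u) /\
    {ae leb2, forall z, Omega z -> weak_partial Omega al u z = c}.
  move=> e; have wu := smooth_weak_partial al mO smooth_sqr_fst.
  have wr := weak_partialP wu; split.
    by apply: locally_integrable_measurable => //; case: wr.
  by apply: ae_impl (weak_partial_unique oO wr wu) => z hz Oz; rewrite hz// e.
have dxx : dx (fun z : R * R => z.1 + z.1) = cst 2.
  rewrite (dx_fst (fun t => t + t)); apply/funext => z; rewrite derive1E.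
  by rewrite deriveD// !derive_id.
have [m0 a0] := rep (0, 2)%N 0 ltac:(by rewrite /= (dy_fst (fun t => t ^+ 2)) dy_cst).
have [m1 a1] := rep (1, 1)%N 0 ltac:(by rewrite /= dx_sqr_fst (dy_fst (fun t => t + t))).
have [m2 a2] := rep (2, 0)%N 2 ltac:(by rewrite /= dx_sqr_fst dxx).
rewrite sobolev_seminorm2E -Rintegral_cst//; congr Num.sqrt.
move: (weak_partial Omega (0, 2)%N u) (weak_partial Omega (1, 1)%N u)
  (weak_partial Omega (2, 0)%N u) m0 a0 m1 a1 m2 a2 => f0 f1 f2 m0 a0 m1 a1 m2 a2.
apply: (ae_eq_Rintegral mO) => //.
  by apply: measurable_funD; [|apply: measurable_funD]; apply: measurable_funX.
apply: ae_impl (ae_and a0 (ae_and a1 a2)) => z [h0 [h1 h2]] Oz.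
by rewrite h0// h1// h2//; ring.
Qed.

End Seminorms.

(** * Convexity, edges and boundary of polygons *)

Section PolygonGeneralities.
Local Open Scope convex_scope.
Variable R : realType.
Implicit Types (s : seq (R * R)) (f : (R * R) * (R * R)) (z : R * R).

Lemma edge_ptE f t :
  edge_pt f t = ((1 - t) * f.1.1 + t * f.2.1, (1 - t) * f.1.2 + t * f.2.2).
Proof. reflexivity. Qed.

Lemma polygon_region_convex s (p q : R * R) t :
  polygon_region s p -> polygon_region s q -> 0 <= t -> t <= 1 ->
  polygon_region s (edge_pt (p, q) t).
Proof.
move=> Pp Pq t0 t1 A [cA sA].
pose l : {i01 R} := Itv01 t0 t1.
have Ap := Pp A (conj cA sA); have Aq := Pq A (conj cA sA).
have /set_mem : ((q : convex_lmodType (R * R)%type) <| l |> p) \in A by apply: cA; exact: mem_set.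
suff -> : ((q : convex_lmodType (R * R)%type) <| l |> p) = edge_pt (p, q) t by [].
by rewrite /edge_pt addrC.
Qed.

Lemma polygon_region_vertex s z : z \in s -> polygon_region s z.
Proof. by move=> zs A [_]; exact. Qed.

Lemma edges_vertices s f : f \in edges s -> f.1 \in s /\ f.2 \in s.
Proof.
move=> fe; split.
  by have := map_f fst fe; rewrite [map _ _]unzip1_zip ?size_rot.
by have := map_f snd fe; rewrite [map _ _]unzip2_zip ?size_rot// mem_rot.
Qed.

Lemma vertex_edge s z : z \in s -> exists2 f, f \in edges s & f.1 = z.
Proof.
rewrite -{1}(@unzip1_zip _ _ s (rot 1 s)) ?size_rot//.
by move=> /mapP[f fe ->]; exists f.
Qed.

Lemma edges_neq s f : uniq s -> (2 < size s)%N -> f \in edges s -> f.1 != f.2.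
Proof.
case: s => [//|x s] us ss; rewrite /edges rot1_cons => /(nthP (x, x))[i].
rewrite size_zip size_rcons minnn => /= ilt <-.
rewrite nth_zip ?size_rcons//= nth_rcons.
have [il|il] := ltnP i (size s).
  rewrite -[nth x s i]/(nth x (x :: s) i.+1).
  have il1 : (i.+1 < size (x :: s))%N by [].
  by rewrite (nth_uniq x (ilt : i < size (x :: s))%N il1 us) ltn_eqF.
(* The last pair is the closing edge, from the last vertex back to the first. *)
have -> : i = size s by apply/eqP; rewrite eqn_leq il -ltnS ilt.
rewrite eqxx -[X in _ != X]/(nth x (x :: s) 0) nth_uniq//=.
by case: (s) ss.
Qed.

Lemma edge_region s f t : f \in edges s -> 0 <= t -> t <= 1 ->
  polygon_region s (edge_pt f t).
Proof.
move=> /edges_vertices[f1 f2] t0 t1; rewrite [f]surjective_pairing.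
by apply: polygon_region_convex => //; exact: polygon_region_vertex.
Qed.

(** A limit point outside the interior is a boundary point, hence on an edge, and edges lie in the
    hull. *)
Lemma convex_polygon_closed s : convex_polygon s -> closed (polygon_region s).
Proof.
move=> [_ _ _ bd _] z cz; case: (asboolP ((polygon_region s)° z)) => [|iz].
  exact: interior_subset.
have : boundary (polygon_region s) z by split.
rewrite bd => -[f /= fe [t]]; rewrite /= in_itv/= => /andP[t0 t1] <-.
exact: edge_region.
Qed.

Lemma edge_boundary s f t : convex_polygon s -> f \in edges s -> 0 <= t -> t <= 1 ->
  ~ (polygon_region s)° (edge_pt f t).
Proof.
move=> [_ _ _ bd _] fe t0 t1.
have : boundary (polygon_region s) (edge_pt f t).
  by rewrite bd; exists f => //; exists t => //=; rewrite in_itv/= t0 t1.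
by case.
Qed.

Lemma diameter1_dist s p q : diameter (polygon_region s) = 1 ->
  polygon_region s p -> polygon_region s q -> dist p q <= 1.
Proof.
rewrite /diameter; set S := [set _ | _ in _] => S1 Pp Pq.
have hS : has_sup S.
  (* [sup] is [0] by convention when no supremum exists, which diameter [1] excludes. *)
  by apply: contrapT => /sup_out S0; move: S1; rewrite S0 => /eqP; rewrite eq_sym oner_eq0.
by rewrite -S1; apply: (sup_upper_bound hS); exists (p, q).
Qed.

Lemma dist_ge_dx p q : `|p.1 - q.1| <= @dist R p q.
Proof. by rewrite /dist -sqrtr_sqr ler_wsqrtr// lerDl sqr_ge0. Qed.

Lemma dist_ge_dy p q : `|p.2 - q.2| <= @dist R p q.
Proof. by rewrite /dist -sqrtr_sqr ler_wsqrtr// lerDr sqr_ge0. Qed.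

Definition halfplane (al be ga : R) : set (R * R) :=
  [set z | 0 < al * z.1 + be * z.2 + ga].

Lemma open_halfplane al be ga : open (halfplane al be ga).
Proof.
rewrite (_ : halfplane _ _ _ = (fun z : R * R => al * z.1 + be * z.2 + ga) @^-1` `]0, +oo[%classic).
  apply: open_comp; last exact: interval_open.
  move=> z _; apply: cvgD; last exact: cvg_cst.
  by apply: cvgD; apply: cvgM; [exact: cvg_cst|exact: cvg_fst|exact: cvg_cst|exact: cvg_snd].
by apply/seteqP; split => z; rewrite /halfplane /= in_itv/= andbT.
Qed.

End PolygonGeneralities.

(** * Geometry of one thin polygon *)

Section ThinPolygon.
Variable R : realType.
Variables (s : seq (R * R)) (v : R * R) (e : (R * R) * (R * R)) (c : R).
Hypotheses (hP : convex_polygon s) (hv : v \in s) (he : e \in edges s).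
Hypothesis A1 : diameter (polygon_region s) = 1.
Hypotheses (A2 : e.1.2 = 0 /\ e.2.2 = 0) (A3 : v.1 = 0 /\ 0 < v.2).
Hypothesis A4 : exists2 m : R, 0 <= m &
  forall z, polygon_region s z -> z.2 <= v.2 + m * (z.1 - v.1).
Hypotheses (c0 : 0 < c) (A5 : c < dist (0, 0) e.1 /\ c < dist (0, 0) e.2).
Hypothesis A6 : dist_to_set v (segment e) < c.

Local Notation P := (polygon_region s).

Lemma apex_height_le_dist : v.2 <= dist_to_set v (segment e).
Proof.
apply: lb_le_inf.
  by exists (dist v (edge_pt e 0)), (edge_pt e 0) => //; exists 0 => //=; rewrite in_itv/= lexx ler01.
move=> _ [_ [t _ <-] <-]; apply: le_trans (dist_ge_dy _ _); rewrite edge_ptE /=.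
by rewrite (proj1 A2) (proj2 A2) !mulr0 addr0 subr0 ger0_norm// ltW// (proj2 A3).
Qed.

(** Some point of [e] is closer than [c] to [v], so its abscissa is smaller than [c] in absolute
    value. Both ends have abscissas beyond [c], hence they lie on opposite sides. *)
Lemma base_endpoints : (e.1.1 < - c /\ c < e.2.1) \/ (e.2.1 < - c /\ c < e.1.1).
Proof.
have c_gt0 := c0.
have [ea eb] := A2; have [a5 b5] := A5.
have hd p : p.2 = 0 -> c < dist (0, 0) p -> c < `|p.1|.
  by rewrite /dist /= => ->; rewrite subrr expr0n /= addr0 sub0r sqrrN sqrtr_sqr.
have {}a5 := hd _ ea a5; have {}b5 := hd _ eb b5.
have [d [z [t tI <-] <-] dc] : exists2 y, [set dist v z | z in segment e] y & y < c.
  apply: inf_lt A6.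
  by exists (dist v (edge_pt e 0)), (edge_pt e 0) => //; exists 0 => //=; rewrite in_itv/= lexx ler01.
move: tI; rewrite /= in_itv/= => /andP[t0 t1].
have := le_lt_trans (dist_ge_dx _ _) dc; rewrite edge_ptE /= (proj1 A3) sub0r normrN ltr_norml => /andP[h1 h2].
move: a5 b5; rewrite !lter_normr => /orP[a5|a5] /orP[b5|b5]; first last.
- by exfalso; nra.
- by left; split; lra.
- by right; split; lra.
- by exfalso; nra.
Qed.

Lemma base_points : exists A B : R,
  [/\ A < - c, c < B, P (A, 0), P (B, 0) &
      forall x, A <= x -> x <= B -> exists t, [/\ 0 <= t, t <= 1 & edge_pt e t = (x, 0)]].
Proof.
have c_gt0 := c0.
have [ea eb] := A2; have [e1 e2] := edges_vertices he.
have E1 : e.1 = (e.1.1, 0) by rewrite [LHS]surjective_pairing ea.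
have E2 : e.2 = (e.2.1, 0) by rewrite [LHS]surjective_pairing eb.
have P1 : P (e.1.1, 0) by rewrite -E1; exact: polygon_region_vertex.
have P2 : P (e.2.1, 0) by rewrite -E2; exact: polygon_region_vertex.
have [[h1 h2]|[h1 h2]] := base_endpoints.
  exists e.1.1, e.2.1; split => // x hx1 hx2.
  have d0 : 0 < e.2.1 - e.1.1 by lra.
  exists ((x - e.1.1) / (e.2.1 - e.1.1)); split.
  - by apply: divr_ge0; lra.
  - by rewrite ler_pdivrMr//; lra.
  - by rewrite edge_ptE ea eb !mulr0 addr0; congr pair; field; lra.
exists e.2.1, e.1.1; split => // x hx1 hx2.
have d0 : 0 < e.1.1 - e.2.1 by lra.
exists ((e.1.1 - x) / (e.1.1 - e.2.1)); split.
- by apply: divr_ge0; lra.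
- by rewrite ler_pdivrMr//; lra.
- by rewrite edge_ptE ea eb !mulr0 addr0; congr pair; field; lra.
Qed.

Lemma region_abscissa_le1 z : P z -> `|z.1| <= 1.
Proof.
have c_gt0 := c0.
have [A [B [h1 h2 _ _ h]]] := base_points.
have [t [t0 t1 t2]] : exists t, [/\ 0 <= t, t <= 1 & edge_pt e t = (0, 0)].
  by apply: h; lra.
have P0 : P (0, 0) by rewrite -t2; exact: edge_region.
move=> Pz; have := diameter1_dist A1 Pz P0.
by apply: le_trans; apply: le_trans (dist_ge_dx _ _); rewrite subr0.
Qed.

(* Every inequality is multiplied by [q.2], so that the lemma applies to an apex [q]
   on either side of the base [(A, 0)-(B, 0)]. *)
Lemma cone_sub_region (A B : R) (q z : R * R) : P (A, 0) -> P (B, 0) -> A < B -> P q -> 0 < q.2 * q.2 ->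
  0 <= z.2 * q.2 -> z.2 * q.2 < q.2 * q.2 ->
  A * (q.2 - z.2) * q.2 <= (q.2 * z.1 - z.2 * q.1) * q.2 ->
  (q.2 * z.1 - z.2 * q.1) * q.2 <= B * (q.2 - z.2) * q.2 -> P z.
Proof.
move=> PA PB AB Pq q0 z0 zq hA hB.
have qn : q.2 != 0 by apply: contraTneq q0 => ->; rewrite mulr0 ltxx.
have d0 : 0 < (q.2 - z.2) * q.2 by rewrite mulrBl subr_gt0.
have dn : q.2 - z.2 != 0 by apply: contraTneq d0 => ->; rewrite mul0r ltxx.
(* [x] is the projection of [z] from [q] onto the base line, and [t] the position of [z] between
   that foot and [q]. *)
pose t := z.2 / q.2; pose x := (q.2 * z.1 - z.2 * q.1) / (q.2 - z.2).
have tE : t = z.2 * q.2 / (q.2 * q.2) by rewrite /t; field.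
have xE : x = (q.2 * z.1 - z.2 * q.1) * q.2 / ((q.2 - z.2) * q.2).
  by rewrite /x; field; apply/andP.
have Ax : A <= x by rewrite xE ler_pdivlMr// mulrA.
have xB : x <= B by rewrite xE ler_pdivrMr// mulrA.
have Px : P (x, 0).
  have AB0 : 0 < B - A by lra.
  rewrite (_ : (x, 0) = edge_pt ((A, 0), (B, 0)) ((x - A) / (B - A))).
    apply: polygon_region_convex => //; first by apply: divr_ge0; lra.
    by rewrite ler_pdivrMr//; lra.
  by rewrite edge_ptE /= !mulr0 addr0; congr pair; field; lra.
rewrite (_ : z = edge_pt ((x, 0), q) t); last first.
  rewrite edge_ptE [LHS]surjective_pairing /= mulr0 add0r /t /x; congr pair.
    by field; apply/andP.
  by field.
apply: polygon_region_convex => //; rewrite tE; first by rewrite divr_ge0// ltW.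
by rewrite ler_pdivrMr// mul1r ltW.
Qed.

(** The point satisfies strictly the four inequalities of [cone_sub_region], and these cut out an
    open set. *)
Lemma cone_interior (A B : R) (q : R * R) y : P (A, 0) -> P (B, 0) -> P q ->
  A < q.1 -> q.1 < B -> 0 < y -> y < q.2 -> P° (q.1, y).
Proof.
move=> PA PB Pq Aq qB y0 yq; have q0 : 0 < q.2 by lra.
pose U := halfplane 0 1 0 `&` halfplane 0 (-1) q.2 `&`
  (halfplane q.2 (A - q.1) (- (A * q.2)) `&` halfplane (- q.2) (q.1 - B) (B * q.2)).
have oU : open U by rewrite /U; do ![exact: open_halfplane|apply: openI].
have UP : U `<=` P.
  move=> z [[]]; rewrite /halfplane /= => h1 h2 [h3 h4].
  by apply: (@cone_sub_region A B q) => //; nra.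
suff Uq : U (q.1, y) by move: UP; rewrite open_subsetE// => /(_ _ Uq).
by rewrite /U /halfplane /=; split; split => /=; nra.
Qed.

(** A point [z] below the base would, together with [v], surround the origin by two triangles on the
    base. The origin would then be interior, although it lies on the edge [e]. *)
Lemma region_above_base z : P z -> 0 <= z.2.
Proof.
have c_gt0 := c0.
move=> Pz; rewrite leNgt; apply/negP => z0.
have [A [B [Ac cB PA PB h]]] := base_points.
have [t [t0 t1 t2]] : exists t, [/\ 0 <= t, t <= 1 & edge_pt e t = (0, 0)].
  by apply: h; lra.
apply: (edge_boundary hP he t0 t1); rewrite t2.
have [v1 v2] := A3; have Pv := polygon_region_vertex hv.
pose U := (halfplane 0 1 (- z.2) `&` halfplane 0 (-1) v.2) `&`
  ((halfplane v.2 (A - v.1) (- (A * v.2)) `&` halfplane (- v.2) (v.1 - B) (B * v.2)) `&`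
  (halfplane (- z.2) (z.1 - A) (A * z.2) `&` halfplane z.2 (B - z.1) (- (B * z.2)))).
have oU : open U by rewrite /U; do ![exact: open_halfplane|apply: openI].
have UP : U `<=` P.
  move=> w [[]]; rewrite /halfplane /= => h1 h2 [[h3 h4] [h5 h6]].
  have [w0|w0] := leP 0 w.2; first by apply: (@cone_sub_region A B v) => //; nra.
  by apply: (@cone_sub_region A B z) => //; nra.
suff Uq : U (0, 0) by move: UP; rewrite open_subsetE// => /(_ _ Uq).
by rewrite /U /halfplane /= v1; split; split => /=; try split => /=; nra.
Qed.

(* The supporting line through [v] lies above [(A, 0)] with [A < - c], so its slope is
   at most [v.2 / c]. *)
Lemma region_height z : P z -> z.2 <= v.2 + v.2 / c.
Proof.
have c_gt0 := c0.
move=> Pz; have [m m0 hm] := A4; have [v1 v2] := A3.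
have [A [B [Ac cB PA PB h]]] := base_points.
have := hm _ PA; have := hm _ Pz; rewrite v1 !subr0 /= => hz hA.
have mc : m <= v.2 / c by rewrite ler_pdivlMr//; nra.
have := region_abscissa_le1 Pz; rewrite ler_norml => /andP[z1 z2]; nra.
Qed.

Lemma region_height_left z : P z -> z.1 <= 0 -> z.2 <= v.2.
Proof.
by move=> Pz z1; have [m m0 hm] := A4; have := hm _ Pz; rewrite (proj1 A3) subr0; nra.
Qed.

(** The base is longer than [2 c]. This makes [c^2/4] smaller than [c], so that the strip stays over
    the base. *)
Lemma double_c_lt1 : 2 * c < 1.
Proof.
have c_gt0 := c0.
have [A [B [Ac cB PA PB h]]] := base_points.
have := diameter1_dist A1 PB PA => /(le_trans (dist_ge_dx _ _)) /=.
by rewrite ler_norml => /andP[]; lra.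
Qed.

(** [tau] is the supremum of the vertical section, attained because the region is closed. Everything
    strictly between the base and that point is interior by [cone_interior] with apex [(x, tau)]. *)
Lemma section_top x : - c < x -> x < 0 -> exists2 tau : R, 0 < tau <= v.2 &
  P (x, tau) /\ forall y, P° (x, y) <-> 0 < y < tau.
Proof.
have c_gt0 := c0.
move=> cx x0; have [v1 v2] := A3; have Pv := polygon_region_vertex hv.
have [A [B [Ac cB PA PB h]]] := base_points.
have A0 : A < 0 by lra.
pose S := [set y | P (x, y)].
(* The point of abscissa [x] on the segment from [(A, 0)] to [v]; it shows that the supremum is
   positive. *)
have Py0 : P (x, v.2 * (1 - x / A)).
  rewrite (_ : (x, _) = edge_pt ((A, 0), v) (1 - x / A)).
    apply: polygon_region_convex => //.
      by rewrite subr_ge0 ler_ndivrMr// mul1r; lra.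
    by rewrite lerBlDr lerDl mulr_le0// ?invr_le0; lra.
  by rewrite edge_ptE /= v1; congr pair; field; lra.
have y00 : 0 < v.2 * (1 - x / A).
  by apply: mulr_gt0 => //; rewrite subr_gt0 ltr_ndivrMr// mul1r; lra.
have ubS : has_ubound S by exists v.2 => y Sy; exact: (region_height_left Sy (ltW x0)).
have hS : has_sup S by split => //; exists (v.2 * (1 - x / A)).
have tau0 : 0 < sup S by apply: lt_le_trans y00 _; exact: (ub_le_sup ubS).
have Ptau : P (x, sup S).
  apply: (convex_polygon_closed hP) => U /nbhs_ballP[r /= r0 rU].
  have [y Sy hy] := sup_adherent r0 hS.
  exists (x, y); split => //; apply: rU; split => /=; first exact: ballxx.
  have hle : y <= sup S by exact: (ub_le_sup ubS Sy).
  by rewrite /ball/= ger0_norm ?subr_ge0// ltrBlDr addrC -ltrBlDr.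
exists (sup S).
  by rewrite tau0 /=; exact: (region_height_left Ptau (ltW x0)).
split => // y; split => [iP|/andP[y0 yt]]; last first.
  by apply: (@cone_interior A B (x, sup S)) => //=; lra.
have /nbhs_ballP[r /= r0 rP] : nbhs (x, y) P by [].
have hr y' : `|y - y'| < r -> P (x, y').
  by move=> yy; apply: rP; split => //=; exact: ballxx.
apply/andP; split.
  have : P (x, y - r / 2) by apply: hr; rewrite opprB addrC subrK gtr0_norm; lra.
  by move=> /region_above_base /=; lra.
have /(ub_le_sup ubS) : S (y + r / 2) by apply: hr; rewrite opprD addrA subrr sub0r normrN gtr0_norm; lra.
lra.
Qed.

(* An edge crossing the y-axis away from the base would pass through [v] without
   having it as an endpoint, against the simplicity of the boundary. *)
Lemma no_crossing_edge f t x tau : f \in edges s -> 0 <= t -> t <= 1 ->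
  edge_pt f t = (x, tau) -> - c < x -> x < 0 -> 0 < tau -> f.1.1 <= 0 /\ f.2.1 <= 0.
Proof.
have c_gt0 := c0.
move=> fe t0 t1 ft cx x0 tau0; have [v1 v2] := A3; have Pv := polygon_region_vertex hv.
have [A [B [Ac cB PA PB h]]] := base_points.
have [f1 f2] := edges_vertices fe.
have f10 := region_above_base (polygon_region_vertex f1); have f20 := region_above_base (polygon_region_vertex f2).
move: (ft); rewrite edge_ptE => -[ftx fty].
apply: contrapT => hcross.
(* The edge contains a point with [x < 0], so an end on the right forces the other one strictly to
   the left. *)
have sgn : f.1.1 * f.2.1 < 0.
  have [h1|h1] := leP f.1.1 0; have [h2|h2] := leP f.2.1 0.
  - by exfalso; apply: hcross.
  - have h3 : f.1.1 < 0.
      rewrite ltNge; apply/negP => h3; have f0 : f.1.1 = 0 by lra.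
      have : 0 <= t * f.2.1 by rewrite mulr_ge0// ltW.
      by move: ftx; rewrite f0 mulr0 add0r => ->; lra.
    by rewrite pmulr_llt0.
  - have h3 : f.2.1 < 0.
      rewrite ltNge; apply/negP => h3; have f0 : f.2.1 = 0 by lra.
      have : 0 <= (1 - t) * f.1.1 by rewrite mulr_ge0 ?subr_ge0// ltW.
      by move: ftx; rewrite f0 mulr0 addr0 => ->; lra.
    by rewrite pmulr_rlt0.
  - have a1 : 0 <= (1 - t) * f.1.1 by rewrite mulr_ge0 ?subr_ge0// ltW.
    have a2 : 0 <= t * f.2.1 by rewrite mulr_ge0// ltW.
    by exfalso; lra.
(* The parameter at which the edge meets the y-axis. *)
pose r := f.1.1 / (f.1.1 - f.2.1).
have dn : f.1.1 - f.2.1 != 0 by apply/eqP => d0; nra.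
have r01 : 0 < r /\ r < 1.
  have d2 : 0 < (f.1.1 - f.2.1) * (f.1.1 - f.2.1) by rewrite -expr2 exprn_even_gt0.
  have -> : r = f.1.1 * (f.1.1 - f.2.1) / ((f.1.1 - f.2.1) * (f.1.1 - f.2.1)).
    by rewrite /r; field.
  split; first by apply: divr_gt0 => //; nra.
  by rewrite ltr_pdivrMr//; nra.
have [r0 r1] := r01.
have fr1 : (1 - r) * f.1.1 + r * f.2.1 = 0 by rewrite /r; field.
clearbody r.
set y := (1 - r) * f.1.2 + r * f.2.2.
have frE : edge_pt f r = (0, y) by rewrite edge_ptE fr1.
have Py : P (0, y) by rewrite -frE; apply: edge_region => //; lra.
have nPy : ~ P° (0, y) by rewrite -frE; apply: edge_boundary => //; lra.
have y0 : 0 <= y by apply: (region_above_base Py).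
have yv : y <= v.2 by apply: (region_height_left Py).
(* Strictly between the base and [v] the crossing point would be interior. At height [0] the whole
   edge would lie on the base, against [tau > 0]. There remains a crossing at [v]. *)
have [yv'|yv'] := ltP y v.2.
  have [y1|y1] := ltP 0 y.
    by apply: nPy; rewrite -[X in (X, _)]v1; apply: (@cone_interior A B v) => //; lra.
  have : (1 - r) * f.1.2 = 0 /\ r * f.2.2 = 0.
    have : 0 <= (1 - r) * f.1.2 by apply: mulr_ge0; lra.
    have : 0 <= r * f.2.2 by apply: mulr_ge0; lra.
    by rewrite /y in y1; lra.
  move=> [/eqP + /eqP]; rewrite !mulf_eq0 => /orP[/eqP h1|/eqP h1]; first by lra.
  move=> /orP[/eqP h2|/eqP h2]; first by lra.
  by move: tau0; rewrite -fty h1 h2 !mulr0 addr0 ltxx.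
have yE : y = v.2 by lra.
have vf : segment f v.
  exists r; first by rewrite /= in_itv/=; apply/andP; split; lra.
  by rewrite frE yE -v1 -surjective_pairing.
(* The edge starting at [v] may meet [f] only in common endpoints, whereas the endpoints of [f] are
   off the y-axis. *)
have [ev eve evv] := vertex_edge hv.
have [evf|evf] := eqVneq ev f.
  by move: sgn; rewrite -evf evv v1 mul0r ltxx.
have vev : segment ev v.
  exists 0; first by rewrite /= in_itv/= lexx ler01.
  by rewrite edge_ptE subr0 !mul1r !mul0r !addr0 evv -surjective_pairing.
have [_ _ _ _ simple] := hP.
have [_] := simple _ _ eve fe evf v (conj vev vf).
by rewrite !inE => /orP[] /eqP vE; move: sgn; rewrite -vE v1 ?mul0r ?mulr0 ltxx.
Qed.

(** The midpoint of a vertical edge would lie strictly between the base and the higher end, hence in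
    the interior. *)
Lemma nonvertical_edge f t x tau : f \in edges s -> 0 <= t -> t <= 1 ->
  edge_pt f t = (x, tau) -> - c < x -> x < 0 -> f.1.1 != f.2.1.
Proof.
have c_gt0 := c0.
move=> fe t0 t1 ft cx x0; apply/eqP => f12.
have [f1 f2] := edges_vertices fe.
have Pf1 := polygon_region_vertex f1; have Pf2 := polygon_region_vertex f2.
move: (ft); rewrite edge_ptE => -[ftx _].
have fx : f.1.1 = x by rewrite -ftx -f12; ring.
have f21 : f.2.1 = x by rewrite -f12.
have fneq : f.1.2 != f.2.2.
  have [s2 us _ _ _] := hP; apply: contraNneq (edges_neq us s2 fe) => f22.
  by rewrite [f.1]surjective_pairing [f.2]surjective_pairing f12 f22.
have [tau' /andP[tau0 _] [_ hint]] := section_top cx x0.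
have [A [B [Ac cB PA PB h]]] := base_points.
have hm : edge_pt f (1 / 2) = (x, (f.1.2 + f.2.2) / 2).
  by rewrite edge_ptE fx f21; congr pair; field.
have h12 : (0 : R) <= 1 / 2 by lra.
have h12' : (1 / 2 : R) <= 1 by lra.
apply: (edge_boundary hP fe h12 h12'); rewrite hm.
have f10 := region_above_base Pf1; have f20 := region_above_base Pf2.
have [l|l|l] := ltgtP f.1.2 f.2.2; last by move: fneq; rewrite l eqxx.
- rewrite -[X in (X, _)]f21; apply: (@cone_interior A B f.2) => //; lra.
- rewrite -[X in (X, _)]fx; apply: (@cone_interior A B f.1) => //; lra.
Qed.

Lemma top_edge x tau : - c < x -> x < 0 -> 0 < tau -> P (x, tau) -> ~ P° (x, tau) ->
  exists f t, [/\ f \in edges s, 0 <= t <= 1, edge_pt f t = (x, tau), f.1.1 != f.2.1 &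
    (1 - t) * f.1.1 ^+ 2 + t * f.2.1 ^+ 2 <= - x].
Proof.
have c_gt0 := c0.
move=> cx x0 tau0 Pt nPt.
have : boundary P (x, tau) by split => //; exact: subset_closure.
have [_ _ _ -> _] := hP.
move=> [f /= fe [t]]; rewrite /= in_itv/= => /andP[t0 t1] ft.
have [f1 f2] := edges_vertices fe.
exists f, t; split => //; first by rewrite t0 t1.
  exact: (nonvertical_edge fe t0 t1 ft).
have [h1 h2] := no_crossing_edge fe t0 t1 ft cx x0 tau0.
have := region_abscissa_le1 (polygon_region_vertex f1); have := region_abscissa_le1 (polygon_region_vertex f2).
rewrite !ler_norml => /andP[a1 _] /andP[a2 _].
move: ft; rewrite edge_ptE => -[<- _].
(* On [[-1, 0]] the square is at most the opposite, a bound that is linear and so survives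
   interpolation. *)
have b1 : f.1.1 ^+ 2 <= - f.1.1 by nra.
have b2 : f.2.1 ^+ 2 <= - f.2.1 by nra.
nra.
Qed.

Lemma bottom_edge x : - c < x -> x < 0 ->
  exists t, [/\ 0 <= t <= 1, edge_pt e t = (x, 0), e.1.1 != e.2.1 &
    c ^+ 2 + x <= (1 - t) * e.1.1 ^+ 2 + t * e.2.1 ^+ 2].
Proof.
have c_gt0 := c0.
move=> cx x0; have [A [B [Ac cB PA PB h]]] := base_points.
have [t [t0 t1 et]] : exists t, [/\ 0 <= t, t <= 1 & edge_pt e t = (x, 0)] by apply: h; lra.
exists t; split => //; first by rewrite t0 t1.
  by apply/eqP => e12; have := base_endpoints; lra.
have [f1 f2] := edges_vertices he.
have := region_abscissa_le1 (polygon_region_vertex f1); have := region_abscissa_le1 (polygon_region_vertex f2).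
rewrite !ler_norml => /andP[a1 a1'] /andP[a2 a2'].
move: et; rewrite edge_ptE => -[xE _].
have -> : (1 - t) * e.1.1 ^+ 2 + t * e.2.1 ^+ 2 = (e.1.1 + e.2.1) * x - e.1.1 * e.2.1.
  by rewrite -xE; ring.
have d : dist e.1 e.2 <= 1 by apply: diameter1_dist A1 _ _; exact: polygon_region_vertex.
have := le_trans (dist_ge_dx _ _) d; rewrite ler_norml => /andP[d1 d2].
(* With end abscissas [a], [b]: [- a b > c^2], and [a + b <= 1] because one is negative and the
   other at most [1]; then [x < 0] gives [(a + b) x >= x]. *)
have [[h1 h2]|[h1 h2]] := base_endpoints; nra.
Qed.

End ThinPolygon.

(** * Slices of the strip and transport of edge integrals to the abscissa *)

Section Traces.
Variable R : realType.
Local Notation leb := (@lebesgue_measure R).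
Local Notation leb2 := (leb \x leb)%E.
Local Notation plane := (measurableTypeR R * measurableTypeR R)%type.
Implicit Types (Omega K : set (R * R)) (phi : R * R -> R) (F : R -> R).

Definition strip (a b : R) : set (R * R) := `]a, b[ `*` [set: R].

Lemma open_strip a b : open (strip a b).
Proof.
rewrite (_ : strip a b = fst @^-1` `]a, b[%classic); last first.
  by apply/seteqP; split => z; [case|].
by apply: open_comp; [move=> z _; exact: cvg_fst|exact: interval_open].
Qed.

Lemma slice_integral phi x tau : smooth phi -> 0 < tau ->
  (\int[leb]_(y in `]0%R, tau[) (dy phi (x, y))%:E = (phi (x, tau) - phi (x, 0))%:E)%E.
Proof.
move=> sphi tau0; have cd := smooth_continuous (smooth_dy sphi).
have dE y : dy phi (x, y) = (fun t => phi (x, t))^`()%classic y by rewrite dyE.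
have dphi (t : R) : derivable (fun t => phi (x, t)) t (1 : R).
  by apply: derivable_sectiony; exact: smooth_differentiable.
have cy : continuous (fun y => dy phi (x, y)).
  by move=> y; apply: continuous_comp; [exact: continuous_pairr|exact: cd].
have cF' : continuous ((fun t => phi (x, t))^`()%classic : R -> R).
  by rewrite (_ : _^`()%classic = (fun y => dy phi (x, y))) //; apply/funext => y; rewrite dE.
rewrite -(integral_derive1 tau0 dphi cF').
have mcy : measurable_fun (setT : set R) (fun y => dy phi (x, y)) by exact: continuous_measurable_fun.
rewrite -(integral_itv_bndo_bndc (r := tau)); last first.
  rewrite (_ : _^`()%classic = (fun y => dy phi (x, y))); last by apply/funext => y; rewrite dE.
  by apply/measurable_EFinP; exact: measurable_funTS.
rewrite -integral_itv_obnd_cbnd; last first.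
  rewrite (_ : _^`()%classic = (fun y => dy phi (x, y))); last by apply/funext => y; rewrite dE.
  by apply/measurable_EFinP; exact: measurable_funTS.
by apply: eq_integral => y _; rewrite dE.
Qed.

(* Bounding the slices below by [E], instead of computing them, avoids proving that
   the upper boundary [tau] depends measurably on [x]. *)
Lemma vertical_slices Omega K phi E a b : open Omega -> compact K -> Omega `<=` K ->
  smooth phi -> leb.-integrable `]a, b[ (EFin \o E) ->
  (forall x, x \in `]a, b[ -> exists2 tau : R, 0 < tau &
     (forall y, Omega (x, y) <-> 0 < y < tau) /\ E x <= phi (x, 0) - phi (x, tau)) ->
  \int[leb]_(x in `]a, b[) E x <= - \int[leb2]_(z in Omega `&` strip a b) dy phi z.
Proof.
move=> oO cK OK sphi iE sl; set D : set plane := Omega `&` strip a b.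
have mD : measurable D by apply: open_measurable2; apply: openI => //; exact: open_strip.
have cd := smooth_continuous (smooth_dy sphi).
have iD : leb2.-integrable D (EFin \o dy phi).
  by apply: (@continuous_integrable2 _ _ _ K) => // z [/OK].
pose f := (EFin \o dy phi) \_ D.
have if_ : leb2.-integrable setT f by exact: (iffLR (integrable_mkcond _ mD)).
have FE x : x \in `]a, b[ -> exists2 tau : R, fubini_F leb f x = (phi (x, tau) - phi (x, 0))%:E &
    E x <= phi (x, 0) - phi (x, tau).
  move=> xab; have [tau tau0 [h hE]] := sl x xab; exists tau => //.
  rewrite -slice_integral// /fubini_F [RHS]integral_mkcond; apply: eq_integral => y _.
  rewrite /f !patchE.
  have -> : ((x, y) \in D) = (y \in (`]0%R, tau[%classic : set R)).
    apply/idP/idP; rewrite !inE /=; first by move=> [/h]; rewrite in_itv.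
    by rewrite in_itv/= => /h Oxy; split.
  by [].
have F0 x : ~ (x \in `]a, b[) -> fubini_F leb f x = 0%E.
  move=> nx; rewrite /fubini_F; apply: integral0_eq => y _.
  by rewrite /f patchE memNset//; move=> [_ []].
have iF := integrable_fubini_F if_.
have mI : measurable (`]a, b[%classic : set (measurableTypeR R)) by exact: measurable_itv.
have iFI := integrableS measurableT mI (@subsetT _ _) iF.
have FF x : x \in `]a, b[ -> fubini_F leb f x = (fine (fubini_F leb f x))%:E.
  by move=> /FE[tau -> _].
have iFI' : leb.-integrable `]a, b[ (EFin \o (fun x => fine (fubini_F leb f x))).
  by apply: eq_integrable iFI => // x; rewrite inE => /FF.
have -> : \int[leb2]_(z in D) dy phi z = \int[leb]_(x in `]a, b[) fine (fubini_F leb f x).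
  rewrite /Rintegral; congr fine; rewrite integral_mkcond -(integral12_prod_meas1 if_).
  rewrite [RHS]integral_mkcond; apply: eq_integral => x _; rewrite patchE.
  by case: ifPn; rewrite ?inE ?notin_setE; [move/FF|move/F0].
have -> : - (\int[leb]_(x in `]a, b[) fine (fubini_F leb f x)) =
    \int[leb]_(x in `]a, b[) (-1 * fine (fubini_F leb f x)).
  by rewrite RintegralZl// mulN1r.
apply: le_Rintegral => //.
  by have := integrableZl mI (-1) iFI'; apply: eq_integrable.
by move=> x /FE[tau -> hE] /=; rewrite mulN1r opprB.
Qed.

(** An edge may run in either direction: the increasing and the decreasing change of variables both
    produce the factor [|q - p|]. *)
Lemma affine_substitution F p q : continuous F -> p != q ->
  (\int[leb]_(t in `[0%R, 1%R]) (F t)%:E * `|q - p|%:E =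
   \int[leb]_(x in `[Num.min p q, Num.max p q]) (F ((x - p) / (q - p)))%:E)%E.
Proof.
move=> cF pq; pose th x : R := (x - p) / (q - p).
have qp0 : q - p != 0 by rewrite subr_eq0 eq_sym.
have dth (x : R) : is_derive x (1 : R) th (q - p)^-1.
  have h : is_derive x (1 : R) (fun x => x - p) 1.
    by apply: is_derive_eq; rewrite subr0.
  have := @is_deriveZ _ _ _ (fun x => x - p) ((q - p)^-1) x 1 1 h.
  rewrite (_ : _ \*: _ = th); first by rewrite /GRing.scale/= mulr1.
  by apply/funext => y; rewrite /th /GRing.scale/= mulrC.
have th' : th^`()%classic = cst (q - p)^-1.
  by apply/funext => x; rewrite derive1E; have [_ ->] := dth x.
have cth : continuous th.
  by move=> x; apply: differentiable_continuous; apply/derivable1_diffP; have [] := dth x.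
have LR a b : derivable_oo_LRcontinuous th a b.
  split; first by move=> x _; have [] := dth x.
    by apply: cvg_at_right_filter; exact: cth.
  by apply: cvg_at_left_filter; exact: cth.
have cFth : continuous (fun x => F (th x)).
  by move=> x; apply: continuous_comp; [exact: cth|exact: cF].
have cc (A : set_system R) : Filter A -> cvg (th^`()%classic x @[x --> A]).
  by move=> FA; rewrite th'; exact: is_cvg_cst.
have icF a b : leb.-integrable `[a, b] (EFin \o (fun x => F (th x))).
  apply: continuous_compact_integrable; first exact: segment_compact.
  exact: continuous_subspaceT.
have thp : th p = 0 by rewrite /th subrr mul0r.
have thq : th q = 1 by rewrite /th divff.
have [lpq|lqp] := ltP p q.
  have -> : (\int[leb]_(t in `[0%R, 1%R]) (F t)%:E =
      \int[leb]_(x in `[p, q]) (((F \o th) * th^`()%classic)%R x)%:E)%E.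
    rewrite -thp -thq.
    apply: (integration_by_substitution_increasing (ltW lpq) _ _ (cc _ _) (cc _ _) (LR _ _)).
    - by move=> x y _ _ xy; rewrite /th ltr_pM2r ?invr_gt0 ?subr_gt0// ltrD2r.
    - by rewrite th' => x _; exact: cvg_cst.
    - exact: continuous_subspaceT.
  rewrite th' (_ : (fun x => _) = (fun x => (F (th x))%:E * (q - p)^-1%:E)%E)//.
  rewrite integralZr//= -muleA -EFinM ger0_norm ?subr_ge0 ?ltW//.
  by rewrite mulVf// mule1.
have {}lqp : q < p by rewrite lt_neqAle lqp andbT eq_sym.
have -> : (\int[leb]_(t in `[0%R, 1%R]) (F t)%:E =
    \int[leb]_(x in `[q, p]) (((F \o th) * - th^`()%classic)%R x)%:E)%E.
  rewrite -thp -thq.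
  apply: (integration_by_substitution_decreasing (ltW lqp) _ _ (cc _ _) (cc _ _) (LR _ _)).
  - by move=> x y _ _ xy; rewrite /th ltr_nM2r ?invr_lt0 ?subr_lt0// ltrD2r.
  - by rewrite th' => x _; exact: cvg_cst.
  - exact: continuous_subspaceT.
rewrite th' (_ : (fun x => _) = (fun x => (F (th x))%:E * (- (q - p)^-1)%:E)%E)//.
rewrite integralZr//= -muleA -EFinM ltr0_norm ?subr_lt0// mulrNN.
by rewrite mulVf// mule1.
Qed.

(* The gap [F], given in the parameter of an edge with end abscissas [p] and [q], as a
   function of the abscissa; vertical edges are irrelevant and get [0]. *)
Definition edge_error F (p q x : R) : R :=
  if p == q then 0 else
  ((fun x => F ((x - p) / (q - p))) \_ `[Num.min p q, Num.max p q]) x.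

Lemma edge_error_ge0 F p q x : (forall t, 0 <= F t) -> 0 <= edge_error F p q x.
Proof.
by move=> F0; rewrite /edge_error; case: ifP => // _; rewrite patchE; case: ifP.
Qed.

Lemma edge_errorE F p q t : 0 <= t <= 1 -> p != q ->
  edge_error F p q ((1 - t) * p + t * q) = F t.
Proof.
move=> /andP[t0 t1] pq; rewrite /edge_error (negbTE pq) patchE mem_set.
  by congr F; field; rewrite subr_eq0 eq_sym.
by rewrite /= in_itv/= ge_min le_max; case: (ltP p q) => h; apply/andP; split;
  apply/orP; (left; nra) || (right; nra).
Qed.

(** Only an inequality, since []a, b[] may cut off part of the projection of the edge. *)
Lemma edge_error_integral F p q a b : continuous F -> (forall t, 0 <= F t) ->
  leb.-integrable `]a, b[ (EFin \o edge_error F p q) /\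
  \int[leb]_(x in `]a, b[) edge_error F p q x <= `|q - p| * \int[leb]_(t in `[0, 1]) F t.
Proof.
move=> cF F0; rewrite /edge_error.
have mI : measurable (`]a, b[%classic : set (measurableTypeR R)) by exact: measurable_itv.
have [pq|pq] := eqVneq p q.
  split; first by have := @integrable0 _ _ _ leb `]a, b[%classic; apply: eq_integrable.
  by rewrite Rintegral_cst// mul0r mulr_ge0// Rintegral_ge0.
pose G (x : R) : R := F ((x - p) / (q - p)).
set J : set (measurableTypeR R) := `[Num.min p q, Num.max p q]%classic.
have mJ : measurable J by exact: measurable_itv.
have cG : continuous G.
  move=> x; apply: continuous_comp; last exact: cF.
  by apply: cvgM; [apply: cvgB; [exact: cvg_id|exact: cvg_cst]|exact: cvg_cst].
have iJ : leb.-integrable J (EFin \o G).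
  apply: continuous_compact_integrable; first exact: segment_compact.
  exact: continuous_subspaceT.
have iIJ : leb.-integrable (`]a, b[ `&` J) (EFin \o G).
  by apply: integrableS iJ => //; exact: measurableI.
split.
  rewrite (_ : EFin \o _ = (EFin \o G) \_ J); last by rewrite restrict_EFin.
  exact: (iffLR (integrable_restrict _ _ mI _)).
have -> : \int[leb]_(x in `]a, b[) (G \_ J) x = \int[leb]_(x in `]a, b[ `&` J) G x.
  by rewrite Rintegral_mkcondr.
have -> : `|q - p| * \int[leb]_(t in `[0, 1]) F t = \int[leb]_(x in J) G x.
  rewrite /Rintegral -(affine_substitution cF pq) fineM//; first by rewrite mulrC.
  apply: integrable_fin_num => //; apply: continuous_compact_integrable; first exact: segment_compact.
  exact: continuous_subspaceT.
by apply: subset_Rintegral => //; [exact: measurableI|move=> x; exact: F0].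
Qed.

End Traces.

(** * Boundary errors of a smooth approximant *)

Section Assembly.
Variable R : realType.
Local Notation leb := (@lebesgue_measure R).
Local Notation leb2 := (leb \x leb)%E.
Local Notation plane := (measurableTypeR R * measurableTypeR R)%type.
Implicit Types (s : seq (R * R)) (f : (R * R) * (R * R)) (phi g : R * R -> R).

(** The explicit chord of [x^2] stands in for [g], which makes the gap continuous along the edge. *)
Definition trace_gap phi f (t : R) : R :=
  `|phi (edge_pt f t) - ((1 - t) * f.1.1 ^+ 2 + t * f.2.1 ^+ 2)|.

Lemma continuous_trace_gap phi f : continuous phi -> continuous (trace_gap phi f).
Proof.
move=> cphi t; rewrite /trace_gap; apply: cvg_norm; apply: cvgB.
  apply: (@continuous_comp _ _ _ (edge_pt f) phi); last exact: cphi.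
  rewrite /edge_pt; apply: cvgD; apply: cvgZ; try exact: cvg_cst; last exact: cvg_id.
  by apply: cvgB; [exact: cvg_cst|exact: cvg_id].
apply: cvgD; apply: cvgM; try exact: cvg_cst; last exact: cvg_id.
by apply: cvgB; [exact: cvg_cst|exact: cvg_id].
Qed.

Lemma unit_itv_measure : leb `[0, 1]%classic = 1%E.
Proof. by rewrite lebesgue_measure_itv/= lte_fin ltr01 oppr0 adde0. Qed.

(** Cauchy-Schwarz on the parameter interval gives a factor [|q - p|^2]. As the edge has length at
    most [1], this is bounded by the length, the weight used in the boundary norm. *)
Lemma trace_gap_L1 s phi g f : continuous phi ->
  piecewise_linear_interpolant s (fun z => z.1 ^+ 2) g -> f \in edges s ->
  dist f.1 f.2 <= 1 ->
  `|f.2.1 - f.1.1| * \int[leb]_(t in `[0, 1]) trace_gap phi f t <=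
  boundary_L2_norm s (phi \- g).
Proof.
move=> cphi hg fe d1.
have mI : measurable (`[0, 1]%classic : set (measurableTypeR R)) by exact: measurable_itv.
have cG := @continuous_trace_gap phi f cphi.
have cG2 : continuous (fun t => trace_gap phi f t ^+ 2).
  by move=> t; rewrite (_ : (fun t => _) = trace_gap phi f \* trace_gap phi f)//; exact: cvgM (cG t) (cG t).
have iG2 : leb.-integrable `[0, 1] (EFin \o (fun t => trace_gap phi f t ^+ 2)).
  apply: continuous_compact_integrable; first exact: segment_compact.
  exact: continuous_subspaceT.
have Ioo : (leb `[0%R, 1%R]%classic < +oo)%E by rewrite unit_itv_measure ltry.
have mG : measurable_fun (`[0, 1]%classic : set (measurableTypeR R)) (trace_gap phi f).
  by apply: measurable_funTS; exact: continuous_measurable_fun.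
have cs := cauchy_schwarz_finite mI Ioo mG iG2.
have m1 : fine (leb `[0, 1]%classic) = 1 by rewrite unit_itv_measure.
rewrite [X in X * _]m1 mul1r in cs.
set I1 := Rintegral _ _ _ in cs *; set I2 := Rintegral _ _ _ in cs.
have I10 : 0 <= I1 by apply: Rintegral_ge0 => t _; exact: normr_ge0.
have I20 : 0 <= I2 by apply: Rintegral_ge0 => t _; exact: sqr_ge0.
set D := `|f.2.1 - f.1.1|.
have D0 : 0 <= D by exact: normr_ge0.
have Dd : D <= dist f.1 f.2 by rewrite /D distrC; exact: dist_ge_dx.
rewrite -[leLHS]ger0_norm ?mulr_ge0// -sqrtr_sqr; apply: ler_wsqrtr.
have term : dist f.1 f.2 * I2 <=
   \sum_(f <- edges s) dist f.1 f.2 * \int[leb]_(t in `[0, 1]) (phi \- g) (edge_pt f t) ^+ 2.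
  rewrite (big_rem f)//= -[leLHS]addr0 lerD//; last first.
    apply: sumr_ge0 => h _; rewrite mulr_ge0 ?sqrtr_ge0//.
    by apply: Rintegral_ge0 => t _; exact: sqr_ge0.
  rewrite le_eqVlt; apply/orP; left; apply/eqP; congr (_ * _).
  apply: eq_Rintegral => t; rewrite inE => tI.
  by rewrite /trace_gap (hg f fe t tI) real_normK ?num_real.
apply: le_trans term; rewrite exprMn.
have DD : D ^+ 2 <= dist f.1 f.2 by nra.
by apply: ler_pM => //; exact: sqr_ge0.
Qed.

(** The edge above [x] varies with [x]; the sum dominates the error of whichever edge it is. *)
Definition total_error phi (L : seq ((R * R) * (R * R))) (x : R) : R :=
  \sum_(f <- L) edge_error (trace_gap phi f) f.1.1 f.2.1 x.

Lemma trace_gap_ge0 phi f t : 0 <= trace_gap phi f t.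
Proof. exact: normr_ge0. Qed.

Lemma total_error_integral phi L a b M : continuous phi ->
  (forall f, f \in L ->
    `|f.2.1 - f.1.1| * \int[leb]_(t in `[0, 1]) trace_gap phi f t <= M) ->
  leb.-integrable `]a, b[ (EFin \o total_error phi L) /\
  \int[leb]_(x in `]a, b[) total_error phi L x <= (size L)%:R * M.
Proof.
move=> cphi; have mI : measurable (`]a, b[%classic : set (measurableTypeR R)) by exact: measurable_itv.
elim: L => [|f L IH] hM.
  rewrite mul0r (_ : total_error phi [::] = cst 0); last first.
    by apply/funext => x; rewrite /total_error big_nil.
  by split; [exact: (@integrable0 _ _ _ leb `]a, b[%classic)|rewrite Rintegral_cst// mul0r].
have [iL hL] : leb.-integrable `]a, b[ (EFin \o total_error phi L) /\
    \int[leb]_(x in `]a, b[) total_error phi L x <= (size L)%:R * M.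
  by apply: IH => h hh; apply: hM; rewrite inE hh orbT.
have [i1 h1] := edge_error_integral f.1.1 f.2.1 a b (@continuous_trace_gap phi f cphi)
  (trace_gap_ge0 phi f).
have -> : total_error phi (f :: L) =
    fun x => edge_error (trace_gap phi f) f.1.1 f.2.1 x + total_error phi L x.
  by apply/funext => x; rewrite /total_error big_cons.
split; first exact: (integrableD mI i1 iL).
rewrite RintegralD//= -natr1 mulrDl mul1r addrC; apply: lerD => //.
by apply: (le_trans h1); apply: hM; rewrite inE eqxx.
Qed.

Lemma total_error_ge phi L f x : f \in L ->
  edge_error (trace_gap phi f) f.1.1 f.2.1 x <= total_error phi L x.
Proof.
move=> fL; rewrite /total_error (big_rem f)//= lerDl; apply: sumr_ge0 => h _.
by apply: edge_error_ge0 => t; exact: trace_gap_ge0.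
Qed.

End Assembly.

(** * The quotient for one thin polygon *)

Section ThinPolygonEstimate.
Variable R : realType.
Local Notation leb := (@lebesgue_measure R).
Local Notation leb2 := (leb \x leb)%E.
Local Notation plane := (measurableTypeR R * measurableTypeR R)%type.
Variables (s : seq (R * R)) (v : R * R) (e : (R * R) * (R * R)) (c : R).
Hypotheses (hP : convex_polygon s) (hv : v \in s) (he : e \in edges s).
Hypothesis A1 : diameter (polygon_region s) = 1.
Hypotheses (A2 : e.1.2 = 0 /\ e.2.2 = 0) (A3 : v.1 = 0 /\ 0 < v.2).
Hypothesis A4 : exists2 m : R, 0 <= m &
  forall z, polygon_region s z -> z.2 <= v.2 + m * (z.1 - v.1).
Hypotheses (c0 : 0 < c) (A5 : c < dist (0, 0) e.1 /\ c < dist (0, 0) e.2).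
Hypothesis A6 : dist_to_set v (segment e) < c.

Local Notation P := (polygon_region s).
Local Notation Om := ((polygon_region s)°).
Local Notation del := (c ^+ 2 / 4).

Let K : set (R * R) := `[-1, 1] `*` `[0, v.2 + v.2 / c].

Lemma domain_sub_rect : Om `<=` K.
Proof.
move=> z /interior_subset Pz.
have := region_abscissa_le1 he A1 A2 A3 c0 A5 A6 Pz; rewrite ler_norml => h.
have y0 := region_above_base hP hv he A2 A3 c0 A5 A6 Pz.
have y1 := region_height he A1 A2 A3 A4 c0 A5 A6 Pz.
by split; rewrite /= in_itv/=; rewrite ?h ?y0 ?y1.
Qed.

(** Positivity, from a box inside the nonempty interior, makes the denominator of the quotient
    nonzero. *)
Lemma domain_area : 0 < fine (leb2 Om) <= 2 * (v.2 + v.2 / c).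
Proof.
have v20 := proj2 A3; have vc0 : 0 < v.2 / c by apply: divr_gt0.
have oOm : open Om by exact: open_interior.
have mOm : measurable (Om : set plane) by exact: open_measurable2.
have cK : compact K by exact: rect_compact.
have KE : leb2 K = (2 * (v.2 + v.2 / c))%:E.
  by rewrite rect_measure; [congr EFin; ring|lra|lra].
have OK : (leb2 Om <= leb2 K)%E.
  by apply: le_measure; rewrite ?inE//; [exact: compact_measurable2|exact: domain_sub_rect].
have Ofin : leb2 Om \is a fin_num.
  by rewrite ge0_fin_numE//; apply: le_lt_trans OK _; rewrite KE ltry.
apply/andP; split; last by rewrite -lee_fin fineK// -KE.
have [z zO] : Om !=set0 by case: hP.
have [S [OS SO]] := open_box_cover oOm.
move: zO; rewrite {1}OS => -[n _]; set q := (S n).1; set r := (S n).2 => -[].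
rewrite /= !in_itv/= => /andP[h1 h2] _.
have r0 : 0 < r by lra.
have : (leb2 (cbox q r) <= leb2 Om)%E.
  apply: le_measure; rewrite ?inE//; last exact: SO.
  by apply: compact_measurable2; exact: rect_compact.
rewrite rect_measure; [|lra|lra] => h; rewrite -lte_fin fineK//.
by apply: lt_le_trans h; rewrite lte_fin; apply: mulr_gt0; lra.
Qed.

Lemma strip_area : fine (leb2 (Om `&` strip (- del) 0)) <= del * v.2.
Proof.
have v20 := proj2 A3.
have d0 : 0 < del by apply: divr_gt0 => //; exact: exprn_gt0.
set D := _ `&` _; have mD : measurable (D : set plane).
  by apply: open_measurable2; apply: openI; [exact: open_interior|exact: open_strip].
pose J : set (R * R) := `[- del, 0] `*` `[0, v.2].
have cJ : compact J by exact: rect_compact.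
have JE : leb2 J = (del * v.2)%:E.
  by rewrite rect_measure; [congr EFin; ring|lra|lra].
have DJ : D `<=` J.
  move=> z [/interior_subset Pz [/=]]; rewrite in_itv/= => /andP[h1 h2] _.
  have y0 := region_above_base hP hv he A2 A3 c0 A5 A6 Pz.
  have y1 := region_height_left A3 A4 Pz (ltW h2).
  by split; rewrite /= in_itv/=; rewrite ?y0 ?y1//; rewrite !ltW.
have DE : (leb2 D <= leb2 J)%E.
  by apply: le_measure; rewrite ?inE//; exact: compact_measurable2.
rewrite -lee_fin -JE fineK// ge0_fin_numE//.
by apply: le_lt_trans DE _; rewrite JE ltry.
Qed.

(** Over each [x] the errors of the base and of the upper edge are both at most [total_error], hence
    the factor [2]. *)
Lemma strip_integral phi g : smooth phi ->
  piecewise_linear_interpolant s (fun z => z.1 ^+ 2) g ->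
  del * (c ^+ 2 / 2) - 2 * ((size (edges s))%:R * boundary_L2_norm s (phi \- g)) <=
  - \int[leb2]_(z in Om `&` strip (- del) 0) dy phi z.
Proof.
move=> sphi hg; have cphi := smooth_continuous sphi.
have cs := double_c_lt1 he A1 A2 A3 c0 A5 A6.
have d0 : 0 < del by apply: divr_gt0 => //; exact: exprn_gt0.
have dc : del < c by have := c0; nra.
pose M := boundary_L2_norm s (phi \- g).
have [iT hT] : leb.-integrable `](- del), 0%R[ (EFin \o total_error phi (edges s)) /\
    \int[leb]_(x in `]- del, 0[) total_error phi (edges s) x <= (size (edges s))%:R * M.
  apply: total_error_integral => // f fe; apply: trace_gap_L1 => //.
  have [f1 f2] := edges_vertices fe.
  by apply: diameter1_dist A1 _ _; exact: polygon_region_vertex.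
have mI : measurable (`](- del), 0%R[%classic : set (measurableTypeR R)) by exact: measurable_itv.
have Ioo : (leb `](- del)%R, 0%R[%classic < +oo)%E.
  by rewrite lebesgue_measure_itv/= lte_fin oppr_lt0 d0 -EFinB ltry.
have lenI : fine (leb `](- del)%R, 0%R[%classic) = del.
  by rewrite lebesgue_measure_itv/= lte_fin oppr_lt0 d0 -EFinB /= sub0r opprK.
have i1 : leb.-integrable `](- del), 0%R[ (EFin \o cst (c ^+ 2 / 2)).
  exact: integrable_cst_finite.
have i2 : leb.-integrable `](- del), 0%R[ (EFin \o (fun x => 2 * total_error phi (edges s) x)).
  by have := integrableZl mI 2 iT; apply: eq_integrable.
have := @vertical_slices R Om K phi (fun x => c ^+ 2 / 2 - 2 * total_error phi (edges s) x)
  (- del) 0 (@open_interior _ _) (@rect_compact _ _ _ _ _) domain_sub_rect sphi (integrableB mI i1 i2).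
have -> : \int[leb]_(x in `]- del, 0[) (c ^+ 2 / 2 - 2 * total_error phi (edges s) x) =
    del * (c ^+ 2 / 2) - 2 * \int[leb]_(x in `]- del, 0[) total_error phi (edges s) x.
  rewrite (RintegralB mI i1 i2) Rintegral_cst// RintegralZl//.
  by rewrite [X in _ * X - _]lenI mulrC.
move=> H; apply: le_trans (H _); first by rewrite lerB// ler_wpM2l.
move=> x; rewrite in_itv/= => /andP[xd x0].
have cx : - c < x by lra.
have [tau /andP[tau0 _] [Pt hint]] := section_top hP hv he A2 A3 A4 c0 A5 A6 cx x0.
have nPt : ~ Om (x, tau) by move=> /hint; rewrite ltxx andbF.
exists tau => //; split => //.
have [f [t [fe t01 ft fv hf]]] := top_edge hP hv he A1 A2 A3 A4 c0 A5 A6 cx x0 tau0 Pt nPt.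
have [t' [t01' et ev hE]] := bottom_edge he A1 A2 A3 c0 A5 A6 cx x0.
have gapf := total_error_ge phi x fe.
have gape := total_error_ge phi x he.
have xf : x = (1 - t) * f.1.1 + t * f.2.1 by move: ft; rewrite edge_ptE => -[].
have xe : x = (1 - t') * e.1.1 + t' * e.2.1 by move: et; rewrite edge_ptE => -[].
rewrite {1}xf edge_errorE// /trace_gap ft in gapf.
rewrite {1}xe edge_errorE// /trace_gap et in gape.
have := le_trans (ler_norm _) gapf.
rewrite distrC in gape; have := le_trans (ler_norm _) gape.
have := c0; lra.
Qed.

(** The estimate holds for each approximant with two error terms, one from the boundary and one from
    the Sobolev norm, both tending to zero for the fixed polygon. *)
Lemma seminorm_lower_bound w :
  harmonic_interpolant s (fun z => z.1 ^+ 2) w ->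
  del * (c ^+ 2 / 2) <=
  Num.sqrt (del * v.2) * sobolev_seminorm 1 Om ((fun z => z.1 ^+ 2) \- w).
Proof.
move=> [sw _ [g hg [phi [sphi cphi1 cphi2]]]].
have d0 : 0 < del by apply: divr_gt0 => //; exact: exprn_gt0.
set S := sobolev_seminorm _ _ _; set D : set plane := Om `&` strip (- del) 0.
have oOm : open Om by exact: open_interior.
have mD : measurable D by apply: open_measurable2; apply: openI => //; exact: open_strip.
have DO : D `<=` Om by move=> z [].
set m := Num.sqrt (fine (leb2 D)); set N : R := (size (edges s))%:R.
have m0 : 0 <= m by exact: sqrtr_ge0.
have N0 : 0 <= N by exact: ler0n.
have S0 : 0 <= S by exact: sqrtr_ge0.
have step n : del * (c ^+ 2 / 2) <= 2 * (N * boundary_L2_norm s (phi n \- g)) +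
    m * (sobolev_norm 1 Om (phi n \- w) + S).
  have h1 := strip_integral (sphi n) hg.
  have h2 := sobolev_seminorm_triangle oOm (@rect_compact _ _ _ _ _) domain_sub_rect sw (sphi n)
    (@smooth_sqr_fst R) mD DO.
  have h3 : \int[leb2]_(z in D) (dy (phi n) z - dy (fun z : R * R => z.1 ^+ 2) z) =
      \int[leb2]_(z in D) dy (phi n) z.
    by apply: eq_Rintegral => z _; rewrite (dy_fst (fun t => t ^+ 2)) subr0.
  rewrite h3 in h2.
  have h4 : sobolev_seminorm 1 Om (phi n \- w) <= sobolev_norm 1 Om (phi n \- w).
    rewrite -[leLHS]ger0_norm ?sqrtr_ge0// -sqrtr_sqr; apply: ler_wsqrtr.
    by rewrite big_ord_recr /= lerDr; apply: sumr_ge0 => k _; exact: sqr_ge0.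
  have h5 : m * (sobolev_seminorm 1 Om (phi n \- w) + S) <=
      m * (sobolev_norm 1 Om (phi n \- w) + S) by rewrite ler_wpM2l// lerD2r.
  have h6 : - (\int[leb2]_(z in D) dy (phi n) z) <= `|\int[leb2]_(z in D) dy (phi n) z|.
    by rewrite -normrN; exact: ler_norm.
  rewrite addrC -lerBlDr; apply: (le_trans h1); apply: (le_trans h6).
  exact: le_trans h2 h5.
have lim : (2 * (N * boundary_L2_norm s (phi n \- g)) +
    m * (sobolev_norm 1 Om (phi n \- w) + S)) @[n --> \oo] --> 2 * (N * 0) + m * (0 + S).
  apply: cvgD; apply: cvgM; try exact: cvg_cst.
    by apply: cvgM => //; exact: cvg_cst.
  by apply: cvgD => //; exact: cvg_cst.
have : del * (c ^+ 2 / 2) <= 2 * (N * 0) + m * (0 + S).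
  rewrite -(cvg_lim (@Rhausdorff R) lim); apply: limr_ge; first by apply/cvg_ex; eexists; exact: lim.
  by apply: nearW => n; exact: step.
rewrite !mulr0 !add0r => h; apply: (le_trans h); apply: ler_wpM2r => //.
by apply: ler_wsqrtr; exact: strip_area.
Qed.

(** The area of the strip and the squared [H^2] seminorm are both [O(v.2)]; the two square roots
    together give the factor [1 / v.2]. *)
Lemma seminorm_ratio w :
  harmonic_interpolant s (fun z => z.1 ^+ 2) w ->
  del * (c ^+ 2 / 2) / (Num.sqrt del * Num.sqrt (8 * (1 + c^-1))) / v.2 <=
  sobolev_seminorm 1 Om ((fun z => z.1 ^+ 2) \- w) /
  sobolev_seminorm 2 Om (fun z => z.1 ^+ 2).
Proof.
move=> hw; have L := seminorm_lower_bound hw.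
have d0 : 0 < del by apply: divr_gt0 => //; exact: exprn_gt0.
have v20 := proj2 A3; have ci0 : 0 < c^-1 by rewrite invr_gt0.
have /andP[m0 m1] := domain_area.
rewrite sobolev_seminorm2_sqr_fst; last exact: open_interior.
set S := sobolev_seminorm _ _ _ in L *.
have S0 : 0 <= S by exact: sqrtr_ge0.
have k0 : 0 < Num.sqrt (8 * (1 + c^-1)) by rewrite sqrtr_gt0 mulr_gt0// addr_gt0.
have sd0 : 0 < Num.sqrt del by rewrite sqrtr_gt0.
have T0 : 0 < Num.sqrt (4 * fine (leb2 Om)) by rewrite sqrtr_gt0 mulr_gt0.
have sv0 : 0 < Num.sqrt v.2 by rewrite sqrtr_gt0.
have T1 : Num.sqrt (4 * fine (leb2 Om)) <= Num.sqrt (8 * (1 + c^-1)) * Num.sqrt v.2.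
  rewrite -sqrtrM; last by rewrite mulr_ge0// addr_ge0// ltW.
  apply: ler_wsqrtr; have -> : 8 * (1 + c^-1) * v.2 = 4 * (2 * (v.2 + v.2 / c)) by ring.
  by rewrite ler_wpM2l.
have vv : v.2 = Num.sqrt v.2 * Num.sqrt v.2 by rewrite -expr2 sqr_sqrtr// ltW.
rewrite sqrtrM in L; last exact: ltW.
set a := del * _ in L *; have a0 : 0 < a by rewrite mulr_gt0// divr_gt0// exprn_gt0.
rewrite ler_pdivlMr// {1}vv; move: (Num.sqrt v.2) sv0 T1 L => sv sv0 T1 L.
move: (Num.sqrt (4 * _)) T0 T1 => T T0 T1; move: (Num.sqrt (8 * _)) k0 T1 => k k0 T1.
move: (Num.sqrt del) sd0 L => sd sd0 L.
apply: (@le_trans _ _ (a / (sd * k) / (sv * sv) * (k * sv))).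
  by rewrite ler_wpM2l// ltW// !divr_gt0 ?mulr_gt0.
have -> : a / (sd * k) / (sv * sv) * (k * sv) = a / (sd * sv).
  by field; rewrite !gt_eqF.
by rewrite ler_pdivrMr ?mulr_gt0// mulrC.
Qed.

End ThinPolygonEstimate.

(** * Passage to the limit along the sequence *)

Unset Implicit Arguments.
Set Strict Implicit.
Set Printing Implicit Defensive.

Theorem lemma4p3 (R : realType)
    (P : nat -> seq (R * R)) (v : nat -> R * R)
    (e : nat -> (R * R) * (R * R))
    (hP : forall i, convex_polygon (P i))
    (hv : forall i, v i \in P i)
    (he : forall i, e i \in edges (P i))
    (hve : forall i, v i != (e i).1 /\ v i != (e i).2)
    (A1 : forall i, diameter (polygon_region (P i)) = 1)
    (A2 : forall i, (e i).1.2 = 0 /\ (e i).2.2 = 0)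
    (A3 : forall i, (v i).1 = 0 /\ 0 < (v i).2)
    (A4 : forall i, exists2 m : R, 0 <= m &
       forall z, polygon_region (P i) z ->
         z.2 <= (v i).2 + m * (z.1 - (v i).1))
    (A5 : exists2 cv : R, 0 < cv &
       forall i, cv < dist (0, 0) (e i).1 /\ cv < dist (0, 0) (e i).2)
    (A6 : dist_to_set (v i) (segment (e i)) @[i --> \oo] --> (0 : R))
    (u : R * R -> R) (hu : u = fun z => z.1 ^+ 2)
    (I_u : nat -> R * R -> R)
    (hI : forall i, harmonic_interpolant (P i) u (I_u i)) :
  sobolev_seminorm 1 (polygon_region (P i))° (u \- I_u i) /
  sobolev_seminorm 2 (polygon_region (P i))° u @[i --> \oo] --> +oo.
Proof.
subst u; have [c c0 A5c] := A5.
set k := c ^+ 2 / 4 * (c ^+ 2 / 2) / (Num.sqrt (c ^+ 2 / 4) * Num.sqrt (8 * (1 + c^-1))).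
have d0 : 0 < c ^+ 2 / 4 by apply: divr_gt0 => //; exact: exprn_gt0.
have k0 : 0 < k.
  apply: divr_gt0; first by apply: mulr_gt0 => //; apply: divr_gt0 => //; exact: exprn_gt0.
  by apply: mulr_gt0; rewrite sqrtr_gt0// mulr_gt0// addr_gt0// invr_gt0.
(* The target is raised to a positive number so that [k / M1] is a positive threshold for the
   height. *)
apply/cvgryPge => M; pose M1 := Num.max M 1.
have M10 : 0 < M1 by rewrite lt_max ltr01 orbT.
have near_dist (r : R) : 0 < r -> \forall i \near \oo, dist_to_set (v i) (segment (e i)) < r.
  by move=> r0; exact: (cvgr_lt 0 A6).
near=> i.
have dc : dist_to_set (v i) (segment (e i)) < c by near: i; exact: near_dist.
have dk : dist_to_set (v i) (segment (e i)) < k / M1.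
  by near: i; apply: near_dist; exact: divr_gt0.
apply: le_trans (seminorm_ratio (hP i) (hv i) (he i) (A1 i) (A2 i) (A3 i) (A4 i) c0 (A5c i) dc (hI i)).
have v0 := proj2 (A3 i); have vd := apex_height_le_dist (A2 i) (A3 i).
apply: (@le_trans _ _ M1); first by rewrite le_max lexx.
rewrite -/k ler_pdivlMr// mulrC -ler_pdivlMr//.
exact: le_trans vd (ltW dk).
Unshelve. all: by end_near. Qed.
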